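(* There is a universal constant $C>0$ such that, if $u\in C^0(\Omega)$ is an $\infty$-harmonic function in a domain $\Omega\subset\mathbb{R}^2$, then for every ball $B=B(x,r)\Subset\Omega$, $$\int_{\frac14B}-\det D^2u\,dx\ \le\ C\inf_{P\in\mathcal P}\Big\|\frac{u-P}{r}\Big\|_{L^\infty(B)}\Big[|DP|+\Big\|\frac{u-P}{r}\Big\|_{L^\infty(B)}\Big].$$
   Context: $\mathcal P$ is the collection of affine functions $P(x)=b+a\cdot x$, $b\in\mathbb{R}$, $a\in\mathbb{R}^2$. For $B=B(x,r)$, $\frac14B=B(x,r/4)$. A function $u\in C^0(\Omega)$ is $\infty$-harmonic if it is a viscosity solution of $\Delta_\infty u:=D^2u\,Du\cdot Du=0$ in $\Omega$; such functions are locally Lipschitz. For $v\in W^{1,2}_{\rm loc}(\Omega)$, $-\det D^2v$ is the distribution $$\int_\Omega(-\det D^2v)\psi\,dx=\frac12\int_\Omega\big[|Dv|^2\Delta\psi-D^2\psi Dv\cdot Dv\big]\,dx,\qquad\psi\in C_c^\infty(\Omega).$$ It is known that for planar $\infty$-harmonic $u$ this distribution is a nonnegative Radon measure on $\Omega$; $\int_{\frac14B}-\det D^2u\,dx$ denotes the measure of $\frac14B$. *)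

(* Defs.v *)
From HB Require Import structures.
From mathcomp Require Import all_boot all_order all_algebra.
From mathcomp Require Import all_classical all_reals all_analysis.

Set Implicit Arguments.
Unset Strict Implicit.
Unset Printing Implicit Defensive.

Import Order.TTheory GRing.Theory Num.Theory.
Import numFieldNormedType.Exports.

Local Open Scope classical_set_scope.
Local Open Scope ring_scope.

(* The plane is R * R with its product topology, normed-module structure and
   product sigma-algebra.  The norm [`|_|] of MathComp-Analysis on a product is
   the maximum norm, so the Euclidean norm and Euclidean balls are defined
   separately. *)
Notation plane R := (measurableTypeR R * measurableTypeR R)%type.

Section Plane.
Context {R : realType}.
Implicit Types (p q x : plane R) (Omega B K : set (plane R)).

Definition dot p q : R := p.1 * q.1 + p.2 * q.2.

Definition enorm p : R := Num.sqrt (dot p p).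

Definition eball x (r : R) : set (plane R) := [set y | enorm (y - x) < r].

Definition lebesgue2 : {measure set (plane R) -> \bar R} :=
  ((@lebesgue_measure R) \x (@lebesgue_measure R))%E.

Definition domain Omega := [/\ Omega !=set0, open Omega & connected Omega].

Definition compactly_contained B Omega := compact (closure B) /\ closure B `<=` Omega.

(* Affine functions [x |-> b + a . x]; the gradient is the slope [a]. *)
Record affine_fun := AffineFun { aff_const : R; aff_slope : plane R }.

Definition aff_eval (P : affine_fun) x : R := aff_const P + dot (aff_slope P) x.

End Plane.

Section Calculus.
Context {R : realType}.
Implicit Types (f psi phi : plane R -> R) (Omega : set (plane R)).

Definition d1 f : plane R -> R := fun x => 'D_((1, 0) : R * R) f x.
Definition d2 f : plane R -> R := fun x => 'D_((0, 1) : R * R) f x.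

(* C^k on an open set [Omega]; values outside [Omega] are irrelevant. *)
Fixpoint Ck (k : nat) Omega f : Prop :=
  (forall x, Omega x -> {for x, continuous f}) /\
  match k with
  | 0 => True
  | k'.+1 => (forall x, Omega x ->
                derivable f x ((1, 0) : R * R) /\ derivable f x ((0, 1) : R * R))
             /\ Ck k' Omega (d1 f) /\ Ck k' Omega (d2 f)
  end.

(* [psi] in C_c^oo(Omega), extended by zero to the plane. *)
Definition test_function Omega psi : Prop :=
  [/\ forall k, Ck k setT psi,
      compact (closure [set x | psi x != 0])
    & closure [set x | psi x != 0] `<=` Omega].

Definition laplacian f : plane R -> R := fun x => d1 (d1 f) x + d2 (d2 f) x.

(* D^2 f(x) p . p *)
Definition hessian_form f (x p : plane R) : R :=
  d1 (d1 f) x * p.1 * p.1 + d1 (d2 f) x * p.1 * p.2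
  + d2 (d1 f) x * p.2 * p.1 + d2 (d2 f) x * p.2 * p.2.

Definition inf_laplacian f : plane R -> R :=
  fun x => hessian_form f x (d1 f x, d2 f x).

Definition inf_harmonic Omega (u : plane R -> R) : Prop :=
  [/\ Ck 0 Omega u,
      forall phi x, Ck 2 Omega phi -> Omega x ->
        (\forall y \near x, u y - phi y <= u x - phi x) ->
        0 <= inf_laplacian phi x
    & forall phi x, Ck 2 Omega phi -> Omega x ->
        (\forall y \near x, u x - phi x <= u y - phi y) ->
        inf_laplacian phi x <= 0].

End Calculus.

Section DetHessian.
Context {R : realType}.
Implicit Types (f v psi : plane R -> R) (g : plane R -> plane R).
Implicit Types (Omega B K : set (plane R)).

Definition Linfty_norm B f : \bar R :=
  'N[lebesgue2]_+oo[EFin \o (f \_ B)].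

Definition L2loc Omega f : Prop :=
  measurable_fun Omega f /\
  forall K, compact K -> K `<=` Omega -> finite_norm lebesgue2 2%:E (f \_ K).

(* [v] belongs to W^{1,2}_loc(Omega) and [g] represents its weak gradient. *)
Definition W12loc_grad Omega v g : Prop :=
  [/\ L2loc Omega v,
      L2loc Omega (fun x => (g x).1),
      L2loc Omega (fun x => (g x).2)
    & forall psi, test_function Omega psi ->
        (\int[lebesgue2]_(x in Omega) (v x * d1 psi x)%:E
           = - \int[lebesgue2]_(x in Omega) ((g x).1 * psi x)%:E)%E /\
        (\int[lebesgue2]_(x in Omega) (v x * d2 psi x)%:E
           = - \int[lebesgue2]_(x in Omega) ((g x).2 * psi x)%:E)%E].

(* The pairing of the distribution - det D^2 v with [psi], where [g] = Dv. *)
Definition neg_det_hessian Omega g psi : \bar R :=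
  ((2^-1)%:E * \int[lebesgue2]_(x in Omega)
     (enorm (g x) ^+ 2 * laplacian psi x - hessian_form psi x (g x))%:E)%E.

(* A Radon measure on [Omega] is a Borel measure, finite on the compact subsets of
   [Omega]; [mu] is a measure on the plane of which only the restriction to [Omega]
   matters. *)
Definition radon_on Omega (mu : {measure set (plane R) -> \bar R}) : Prop :=
  forall K, compact K -> K `<=` Omega -> (mu K < +oo)%E.

(* The distribution - det D^2 v on [Omega] is the nonnegative Radon measure [mu].
   The weak gradient is unique up to a null set, so it does not matter which
   representative [g] is chosen. *)
Definition neg_det_hessian_measure Omega v
    (mu : {measure set (plane R) -> \bar R}) : Prop :=
  radon_on Omega mu /\
  exists2 g, W12loc_grad Omega v g &
    forall psi, test_function Omega psi ->
      (\int[mu]_(x in Omega) (psi x)%:E)%E = neg_det_hessian Omega g psi.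

End DetHessian.

(* Main.v *)
Require Import Defs.
From HB Require Import structures.
From mathcomp Require Import all_boot all_order all_algebra.
From mathcomp Require Import all_classical all_reals all_analysis.
From mathcomp Require Import measurable_realfun ess_sup_inf.
From mathcomp Require Import ring lra.
Import Order.TTheory GRing.Theory Num.Theory.
Import numFieldNormedType.Exports.
Local Open Scope classical_set_scope.
Local Open Scope ring_scope.

(* Let N be the norm of (u - P) / r on the ball, a = DP and M = |a| + 8 N.  Comparison
   with cones gives u z - u y <= M |z - y| near the centre, so the weak gradient g
   satisfies |g| <= M almost everywhere there.  Since
     |g - a|^2 = |g|^2 - |a|^2 - 2 a.(g - a)   and   M^2 - |a|^2 = 16 N |a| + 64 N^2,
   integrating against a cutoff and moving the derivative in the last term from u - P
   to the cutoff bounds the energy of u - P by C r^2 N (|a| + N).  The distribution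
   - det D^2 is quadratic in the gradient and unchanged when P is subtracted from u;
   paired with a cutoff of size 1 on the quarter ball, whose second derivatives are
   of order r^-2, it is therefore at most C N (|a| + N). *)

Set Implicit Arguments.
Unset Strict Implicit.
Unset Printing Implicit Defensive.

(** * Calculus in the plane *)

(** The coefficient of |a| in M has to be exactly 1: a bound C (|a| + N) with C > 1 would leave in
    M^2 - |a|^2 a multiple of |a|^2, which does not vanish with N. Comparison with cones gives this
    sharp slope because on every small circle the affine part of u contributes no more than |a|, and
    the error no more than a multiple of N. The gradient is known only through its integrals against
    smooth tests, so the slope estimate reaches it by difference quotients: translation invariance
    of the measure moves them from u to the test, and one-sided bounds in all rational directions
    bound the norm. Every test is a product f(x1) g(x2). Such products are closed under partial
    derivatives, reduce smoothness and support to one variable, tend to indicators of rectangles,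
    which is all that the fundamental lemma needs, and serve as cutoffs on squares. *)

(* Unlike [is_derive], not a type class: the shape of the derivative is then
   never chosen by instance resolution. *)
Definition has_deriv {R : realType} (f : R -> R) (x l : R) : Prop :=
  is_derive x 1 f l.

Section calculus.
Context {R : realType}.

Lemma has_deriv_cst (c x : R) : has_deriv (fun=> c) x 0.
Proof. exact: is_derive_cst. Qed.

Lemma has_deriv_id (x : R) : has_deriv (fun t => t) x 1.
Proof. exact: is_derive_id. Qed.

Lemma has_derivD (f g : R -> R) (x a b : R) : has_deriv f x a ->
  has_deriv g x b -> has_deriv (fun t => f t + g t) x (a + b).
Proof. exact: is_deriveD. Qed.

Lemma has_derivM (f g : R -> R) (x a b : R) : has_deriv f x a ->
  has_deriv g x b -> has_deriv (fun t => f t * g t) x (f x * b + g x * a).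
Proof. exact: is_deriveM. Qed.

Lemma has_deriv_comp (f g : R -> R) (x a b : R) : has_deriv f (g x) a ->
  has_deriv g x b -> has_deriv (fun t => f (g t)) x (a * b).
Proof. exact: is_derive1_comp. Qed.

Implicit Types (f g : plane R -> R) (x : plane R).

Lemma has_deriv_fst f x l :
  has_deriv (fun t => f (t, x.2)) x.1 l -> is_derive x ((1, 0) : R * R) f l.
Proof.
set g := fun t => f (t, x.2) => -[gx gl].
have E : (fun h : R => h^-1 *: ((f \o shift x) (h *: ((1, 0) : R * R)) - f x))
    = (fun h : R => h^-1 *: ((g \o shift x.1) (h *: 1) - g x.1)).
  apply/funext => h; congr (_ *: (_ - _)); last by rewrite /g -surjective_pairing.
  by rewrite /g /=; congr (f _); apply/pair_equal_spec; rewrite /= scaler0 add0r.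
by split; rewrite /derivable /derive E.
Qed.

Lemma has_deriv_snd f x l :
  has_deriv (fun t => f (x.1, t)) x.2 l -> is_derive x ((0, 1) : R * R) f l.
Proof.
set g := fun t => f (x.1, t) => -[gx gl].
have E : (fun h : R => h^-1 *: ((f \o shift x) (h *: ((0, 1) : R * R)) - f x))
    = (fun h : R => h^-1 *: ((g \o shift x.2) (h *: 1) - g x.2)).
  apply/funext => h; congr (_ *: (_ - _)); last by rewrite /g -surjective_pairing.
  by rewrite /g /=; congr (f _); apply/pair_equal_spec; rewrite /= scaler0 add0r.
by split; rewrite /derivable /derive E.
Qed.

Lemma d1E {f g} :
  (forall x, has_deriv (fun t => f (t, x.2)) x.1 (g x)) -> d1 f = g.
Proof. by move=> H; apply/funext => x; have /has_deriv_fst[] := H x. Qed.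

Lemma d2E {f g} :
  (forall x, has_deriv (fun t => f (x.1, t)) x.2 (g x)) -> d2 f = g.
Proof. by move=> H; apply/funext => x; have /has_deriv_snd[] := H x. Qed.

End calculus.

(** Only constants, the variable, sums and products are recognised; the polynomials meant for it
    have their squares written as products. *)
Ltac derive_poly :=
  lazymatch goal with
  | |- has_deriv (fun _ => ?c) _ _ => exact: has_deriv_cst
  | |- has_deriv (fun t => t) _ _ => exact: has_deriv_id
  | |- has_deriv (fun t => @?f t + @?g t) _ _ =>
      refine (@has_derivD _ f g _ _ _ _ _); cbv beta; derive_poly
  | |- has_deriv (fun t => @?f t * @?g t) _ _ =>
      refine (@has_derivM _ f g _ _ _ _ _); cbv beta; derive_poly
  end.

Ltac derive_by_ring :=
  eapply eq_rect; [derive_poly | cbv beta; ring].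

Section continuity.
Context {R : realType}.
Implicit Types (f g : plane R -> R).

Definition cont f : Prop := continuous f.

Lemma cont_cst c : cont (fun=> c). Proof. exact: cst_continuous. Qed.
Lemma cont_fst : cont (fun z => z.1 : R). Proof. by move=> z; exact: cvg_fst. Qed.
Lemma cont_snd : cont (fun z => z.2 : R). Proof. by move=> z; exact: cvg_snd. Qed.

Lemma contD f g : cont f -> cont g -> cont (fun z => f z + g z).
Proof. by move=> cf cg z; apply: continuousD; [exact: cf|exact: cg]. Qed.

Lemma contM f g : cont f -> cont g -> cont (fun z => f z * g z).
Proof. by move=> cf cg z; apply: continuousM; [exact: cf|exact: cg]. Qed.

Lemma Ck0 Omega f : cont f -> Ck 0 Omega f.
Proof. by move=> cf; split=> // z _; exact: cf. Qed.

Lemma CkS k Omega {f g h} : cont f ->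
  (forall z : plane R, has_deriv (fun t => f (t, z.2)) z.1 (g z)) ->
  (forall z : plane R, has_deriv (fun t => f (z.1, t)) z.2 (h z)) ->
  Ck k Omega g -> Ck k Omega h -> Ck k.+1 Omega f.
Proof.
move=> cf fg fh Cg Ch; split; first by move=> z _; exact: cf.
split; last by rewrite (d1E fg) (d2E fh).
by move=> z _; have /has_deriv_fst[? _] := fg z; have /has_deriv_snd[? _] := fh z.
Qed.

End continuity.

Ltac cont_poly :=
  lazymatch goal with
  | |- cont (fun _ => ?c) => exact: cont_cst
  | |- cont (fun t => t.1) => exact: cont_fst
  | |- cont (fun t => t.2) => exact: cont_snd
  | |- cont (fun t => @?f t + @?g t) => refine (@contD _ f g _ _); cbv beta; cont_poly
  | |- cont (fun t => @?f t * @?g t) => refine (@contM _ f g _ _); cbv beta; cont_poly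
  end.

Section smooth_cone.
Context {R : realType}.
Variables (p : plane R) (c0 c1 c2 c3 : R).

Let T (z : plane R) : R := (z.1 - p.1) * (z.1 - p.1) + (z.2 - p.2) * (z.2 - p.2).
Let F (t : R) : R := c0 + t * (c1 + t * (c2 + t * c3)).
Let F' (t : R) : R := c1 + t * (2 * c2 + t * (3 * c3)).
Let F'' (t : R) : R := 2 * c2 + t * (6 * c3).

(** A polynomial in the squared distance, hence smooth at [p] too, unlike the cones that it is to
    touch from above. *)
Definition radial_cubic (z : plane R) : R := F (T z).

Let G1 (z : plane R) : R := 2 * (z.1 - p.1) * F' (T z).
Let G2 (z : plane R) : R := 2 * (z.2 - p.2) * F' (T z).
Let H11 (z : plane R) : R := 2 * F' (T z) + 4 * (z.1 - p.1) * (z.1 - p.1) * F'' (T z).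
Let H12 (z : plane R) : R := 4 * (z.1 - p.1) * (z.2 - p.2) * F'' (T z).
Let H22 (z : plane R) : R := 2 * F' (T z) + 4 * (z.2 - p.2) * (z.2 - p.2) * F'' (T z).

Let D1 (z : plane R) : has_deriv (fun t => radial_cubic (t, z.2)) z.1 (G1 z).
Proof. by rewrite /radial_cubic /G1 /F /F' /T /=; derive_by_ring. Qed.
Let D2 (z : plane R) : has_deriv (fun t => radial_cubic (z.1, t)) z.2 (G2 z).
Proof. by rewrite /radial_cubic /G2 /F /F' /T /=; derive_by_ring. Qed.
Let D11 (z : plane R) : has_deriv (fun t => G1 (t, z.2)) z.1 (H11 z).
Proof. by rewrite /H11 /G1 /F'' /F' /T /=; derive_by_ring. Qed.
Let D12 (z : plane R) : has_deriv (fun t => G2 (t, z.2)) z.1 (H12 z).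
Proof. by rewrite /H12 /G2 /F'' /F' /T /=; derive_by_ring. Qed.
Let D21 (z : plane R) : has_deriv (fun t => G1 (z.1, t)) z.2 (H12 z).
Proof. by rewrite /H12 /G1 /F'' /F' /T /=; derive_by_ring. Qed.
Let D22 (z : plane R) : has_deriv (fun t => G2 (z.1, t)) z.2 (H22 z).
Proof. by rewrite /H22 /G2 /F'' /F' /T /=; derive_by_ring. Qed.

(** The gradient is 2 F' (z - p) and the Hessian is 2 F' I + 4 F'' (z - p) (z - p)^T. The last
    factor is half the second derivative of F(s^2) in s, so concavity along rays decides the
    sign. *)
Lemma inf_laplacian_radial_cubic z : inf_laplacian radial_cubic z =
  8 * T z * F' (T z) ^+ 2 * (F' (T z) + 2 * T z * F'' (T z)).
Proof.
rewrite /inf_laplacian /hessian_form (d1E D1) (d2E D2) (d1E D11) (d2E D22).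
rewrite (d1E D12) (d2E D21) /H11 /H12 /H22 /G1 /G2 /= /T.
set e := F' _; set f := F'' _; set a := z.1 - p.1; set b := z.2 - p.2.
ring.
Qed.

Lemma Ck2_radial_cubic Omega : Ck 2 Omega radial_cubic.
Proof.
have cF : cont radial_cubic by rewrite /radial_cubic /F /T; cont_poly.
have cG1 : cont G1 by rewrite /G1 /F' /T; cont_poly.
have cG2 : cont G2 by rewrite /G2 /F' /T; cont_poly.
have cH11 : cont H11 by rewrite /H11 /F' /F'' /T; cont_poly.
have cH12 : cont H12 by rewrite /H12 /F' /F'' /T; cont_poly.
have cH22 : cont H22 by rewrite /H22 /F' /F'' /T; cont_poly.
have C0 f : cont f -> Ck 0 Omega f by exact: Ck0.
have C1 := CkS cF D1 D2 (k := 1).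
apply: C1.
  by apply: (CkS (k := 0) cG1 D11 D21); exact: C0.
by apply: (CkS (k := 0) cG2 D12 D22); exact: C0.
Qed.

End smooth_cone.

(** * Comparison with cones *)

Section cones.
Context {R : realType}.
Implicit Types (p q y z : plane R) (Omega : set (plane R)) (u : plane R -> R).

Lemma enorm_ge0 p : 0 <= enorm p. Proof. exact: sqrtr_ge0. Qed.

Lemma sqr_enorm p : enorm p ^+ 2 = p.1 * p.1 + p.2 * p.2.
Proof. by rewrite sqr_sqrtr// /dot addr_ge0// -expr2 sqr_ge0. Qed.

Lemma enorm_eq0 {p} : enorm p = 0 -> p.1 = 0 /\ p.2 = 0.
Proof.
move=> p0; have := sqr_enorm p; rewrite p0 expr0n/= -!expr2 => /esym/eqP.
by rewrite paddr_eq0 ?sqr_ge0// !sqrf_eq0 => /andP[/eqP-> /eqP->].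
Qed.

Lemma cont_enormB y : cont (fun z => enorm (z - y)).
Proof.
move=> z; rewrite /enorm.
apply: (@continuous_comp _ _ _ (fun z : plane R => dot (z - y) (z - y)) Num.sqrt).
  have : cont (fun z : plane R => (z.1 - y.1) * (z.1 - y.1) +
    (z.2 - y.2) * (z.2 - y.2)) by cont_poly.
  exact.
exact: sqrt_continuous.
Qed.

(* The right-hand side is the third order Taylor polynomial of sqrt at s0^2, evaluated
   at s^2; the difference is (s - s0)^4 (s^2 + 4 s s0 + 5 s0^2) / (16 s0^5).  It provides
   test functions that touch a cone from above and are smooth at its vertex. *)
Lemma le_tangent_cubic (s0 s : R) : 0 < s0 -> 0 <= s ->
  s <= s0 * 5 / 16 + s ^+ 2 * (15 / (16 * s0) + s ^+ 2 * (- 5 / (16 * s0 ^+ 3)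
       + s ^+ 2 * (16 * s0 ^+ 5)^-1)).
Proof.
move=> s00 s0_; rewrite -subr_ge0.
have -> : s0 * 5 / 16 + s ^+ 2 * (15 / (16 * s0) + s ^+ 2 * (- 5 / (16 * s0 ^+ 3)
       + s ^+ 2 * (16 * s0 ^+ 5)^-1)) - s =
   (s - s0) ^+ 4 * (s ^+ 2 + 4 * s * s0 + 5 * s0 ^+ 2) / (16 * s0 ^+ 5).
  by field; lra.
rewrite divr_ge0//; last by rewrite mulr_ge0// exprn_ge0// ltW.
rewrite mulr_ge0//; first by rewrite (_ : 4 = 2 * 2)%N// exprM sqr_ge0.
by rewrite !addr_ge0// ?mulr_ge0// ?sqr_ge0 ?ltW.
Qed.

(** The term - eta s^2 bends the cone so that its infinity-Laplacian is negative away from the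
    vertex: the second radial derivative is - 2 eta, while [2 * eta * rho < b] keeps the radial
    slope, whose square is a factor, from vanishing. Hence u minus the bent cone has no maximum
    inside the disc except possibly at [y], where the difference is [u y]. *)
Lemma cone_comparison_strict Omega u y (rho b eta : R) : inf_harmonic Omega u ->
  0 < eta -> 2 * eta * rho < b ->
  compact [set z | enorm (z - y) <= rho] -> [set z | enorm (z - y) <= rho] `<=` Omega ->
  (forall z, enorm (z - y) = rho -> u z - u y < b * rho - eta * rho ^+ 2) ->
  forall z, enorm (z - y) <= rho ->
    u z - u y <= b * enorm (z - y) - eta * enorm (z - y) ^+ 2.
Proof.
move=> [uC usub _] eta0 etab cK KO ubd.
pose w z := b * enorm (z - y) - eta * enorm (z - y) ^+ 2.
have Cw : cont w.
  rewrite /w (_ : (fun _ => _) =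
    fun z => b * enorm (z - y) + (- eta) * (enorm (z - y) * enorm (z - y))).
    apply: contD; apply: contM; [exact: cont_cst|exact: cont_enormB|exact: cont_cst|].
    by apply: contM; exact: cont_enormB.
  by apply/funext => z; rewrite mulNr expr2.
move=> z1 Kz1.
have [] := @compact_EVT_max _ _ (fun z => u z - w z) _ (ex_intro _ z1 Kz1) cK.
  apply: continuous_in_subspaceT => z; rewrite inE => Kz.
  by apply: continuousB; [exact: uC.1 (KO _ Kz)|exact: Cw].
move=> z0; rewrite inE => Kz0 maxz0.
have {}maxz0 z : enorm (z - y) <= rho -> u z - w z <= u z0 - w z0.
  by move=> Kz; apply: maxz0; rewrite inE.
have [le0|gt0] := leP (u z0 - w z0 - u y) 0.
  by have := maxz0 _ Kz1; rewrite -/(w z1); lra.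
exfalso.
have z0y : 0 < enorm (z0 - y).
  rewrite lt_neqAle enorm_ge0 andbT eq_sym; apply/eqP => e0.
  have [/= e1 e2] := enorm_eq0 e0.
  have z0E : z0 = y.
    rewrite (surjective_pairing z0) (surjective_pairing y).
    by congr pair; apply/eqP; rewrite -subr_eq0; apply/eqP.
  by move: gt0; rewrite /w e0 z0E; rewrite mulr0 expr0n/= mulr0 !subr0 subrr ltxx.
have z0rho : enorm (z0 - y) < rho.
  rewrite lt_neqAle Kz0 andbT; apply/eqP => e0.
  by have := ubd _ e0; move: gt0; rewrite /w e0; lra.
set s0 := enorm (z0 - y) in z0y z0rho gt0.
(* [b] times the polynomial of [le_tangent_cubic], minus [eta * s ^+ 2]: it lies above [w] and
   touches it at [z0]. *)
pose phi := radial_cubic y (b * (s0 * 5 / 16)) (b * (15 / (16 * s0)) - eta)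
   (b * (- 5 / (16 * s0 ^+ 3))) (b * (16 * s0 ^+ 5)^-1).
have b0 : 0 < b.
  by apply: le_lt_trans etab; rewrite mulr_ge0// ?mulr_ge0// ltW// (lt_trans z0y).
have TE z : (z.1 - y.1) * (z.1 - y.1) + (z.2 - y.2) * (z.2 - y.2) =
    enorm (z - y) ^+ 2 by rewrite sqr_enorm.
have phiE z : phi z = b * (s0 * 5 / 16 + enorm (z - y) ^+ 2 * (15 / (16 * s0)
    + enorm (z - y) ^+ 2 * (- 5 / (16 * s0 ^+ 3)
    + enorm (z - y) ^+ 2 * (16 * s0 ^+ 5)^-1))) - eta * enorm (z - y) ^+ 2.
  by rewrite /phi /radial_cubic TE; ring.
have wphi z : w z <= phi z.
  rewrite phiE /w lerD2r ler_pM2l//; apply: le_tangent_cubic => //; exact: enorm_ge0.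
have phiz0 : phi z0 = w z0.
  by rewrite phiE /w -/s0; field; lra.
have := usub phi z0 (Ck2_radial_cubic _ _ _ _ _ _) (KO _ Kz0).
rewrite inf_laplacian_radial_cubic.
rewrite TE -/s0.
set F' := (b * _ - eta + _).
(* [phi] and the bent cone agree to third order in the radius at [s0], so [F'] is the slope of the
   latter over [2 * s0] and [X] is half its second derivative. *)
have F'E : F' = b / (2 * s0) - eta by rewrite /F'; field; lra.
set X := F' + _.
have XE : X = - eta by rewrite /X F'E; field; lra.
rewrite XE => H.
have : 0 <= 8 * s0 ^+ 2 * F' ^+ 2 * - eta.
  apply: H.
  have : \forall z \near z0, enorm (z - y) < rho.
    have := @cont_enormB y z0 => /(_ [set t | t < rho]); apply.
    exact: lt_nbhsl.
  apply: filterS => z zr.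
  have := maxz0 z (ltW zr); have := wphi z; rewrite phiz0; lra.
rewrite mulrN oppr_ge0; apply/negP; rewrite -ltNge.
have F'0 : F' != 0.
  rewrite F'E gt_eqF// subr_gt0 ltr_pdivlMr ?mulr_gt0//.
  by have : eta * s0 < eta * rho; [rewrite ltr_pM2l | lra].
by rewrite mulr_gt0// mulr_gt0 ?exprn_even_gt0// mulr_gt0// exprn_gt0.
Qed.

Lemma cone_comparison Omega u y (rho M : R) : inf_harmonic Omega u ->
  0 < rho -> 0 <= M ->
  compact [set z | enorm (z - y) <= rho] -> [set z | enorm (z - y) <= rho] `<=` Omega ->
  (forall z, enorm (z - y) = rho -> u z - u y <= M * rho) ->
  forall z, enorm (z - y) <= rho -> u z - u y <= M * enorm (z - y).
Proof.
move=> uO rho0 M0 cK KO uM z zrho; apply/ler_addgt0Pr => e e0.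
have s0 := enorm_ge0 (z - y).
(* The slope will be [M + 3 * eta * rho]. On the circle the bent cone then exceeds [M * rho] by
   [2 * eta * rho ^+ 2], the slope exceeds [2 * eta * rho], and the conclusion loses at most [e]. *)
have [eta eta0 etae] : exists2 eta, 0 < eta & 3 * eta * rho * rho = e.
  exists (e / (3 * rho * rho)); first by rewrite divr_gt0// !mulr_gt0.
  by field; lra.
have := @cone_comparison_strict Omega u y rho (M + 3 * eta * rho) eta uO eta0.
move=> /(_ _ cK KO _ z zrho); set s := enorm _ in s0 zrho *.
have etar : 0 < eta * rho by rewrite mulr_gt0.
move=> H; apply: (le_trans (H _ _)).
- by lra.
- move=> z' /uM /le_lt_trans; apply.
  have : 0 < eta * rho * rho by rewrite mulr_gt0.
  rewrite expr2; lra.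
- have : 3 * eta * rho * s <= e.
    by rewrite -etae ler_pM2l// !mulr_gt0.
  have : 0 <= eta * s ^+ 2 by rewrite mulr_ge0 ?sqr_ge0// ltW.
  lra.
Qed.

End cones.

Section enorm_triangle.
Context {R : realType}.
Implicit Types (p q x y z : plane R) (Omega : set (plane R)) (u : plane R -> R).

Lemma dot_le_enorm p q : dot p q <= enorm p * enorm q.
Proof.
apply: (le_trans (ler_norm _)); rewrite -(@ler_pXn2r _ 2) ?nnegrE ?mulr_ge0 ?enorm_ge0//.
rewrite exprMn !sqr_enorm real_normK ?num_real// /dot -subr_ge0.
rewrite (_ : _ - _ = (p.1 * q.2 - p.2 * q.1) ^+ 2) ?sqr_ge0//; ring.
Qed.

Lemma le_enormD p q : enorm (p + q) <= enorm p + enorm q.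
Proof.
rewrite -(@ler_pXn2r _ 2) ?nnegrE ?addr_ge0 ?enorm_ge0// sqrrD !sqr_enorm.
have := dot_le_enorm p q; rewrite /dot /=; set s := _ * enorm q.
lra.
Qed.

Lemma normr_fst_le p : `|p.1| <= enorm p.
Proof.
rewrite -(@ler_pXn2r _ 2) ?nnegrE ?enorm_ge0// sqr_enorm real_normK ?num_real//.
by rewrite -!expr2 lerDl sqr_ge0.
Qed.

Lemma normr_snd_le p : `|p.2| <= enorm p.
Proof.
rewrite -(@ler_pXn2r _ 2) ?nnegrE ?enorm_ge0// sqr_enorm real_normK ?num_real//.
by rewrite -!expr2 lerDr sqr_ge0.
Qed.

Lemma enorm_lt_of_sqr p (s : R) : 0 < s -> p.1 * p.1 + p.2 * p.2 < s ^+ 2 -> enorm p < s.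
Proof. by move=> s0; rewrite -sqr_enorm ltr_pXn2r// nnegrE ?enorm_ge0// ltW. Qed.

(** On the circle of radius r/4 about [y] the affine part of [u z - u y] is at most |a| r/4 and the
    error at most 2 N r, which is 8 N (r/4). The cone of slope |a| + 8 N therefore dominates there,
    and comparison carries this inside. *)
Lemma slope_bound Omega u x (r N : R) (P : @affine_fun R) :
  inf_harmonic Omega u -> 0 < r -> 0 <= N ->
  compactly_contained (eball x r) Omega ->
  (forall y, enorm (y - x) < r -> `|u y - aff_eval P y| <= N * r) ->
  forall y z, `|y.1 - x.1| <= r / 2 -> `|y.2 - x.2| <= r / 2 ->
    enorm (z - y) <= r / 4 ->
    u z - u y <= (enorm (aff_slope P) + 8 * N) * enorm (z - y).
Proof.
move=> uO r0 N0 [cB BO] uP y z y1 y2 zy.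
(* The half-diagonal r / sqrt 2 of the square is less than 3/4 r, so the disc of radius r/4 about
   [y] stays in the ball. *)
have yx : enorm (y - x) < 3 / 4 * r.
  apply: enorm_lt_of_sqr => /=; first by lra.
  rewrite -!expr2 -(real_normK (num_real (y.1 - x.1))) -(real_normK (num_real (y.2 - x.2))).
  have sq (t : R) : 0 <= t -> t <= r / 2 -> t ^+ 2 <= (r / 2) ^+ 2.
    by move=> t0 tr; rewrite ler_pXn2r// nnegrE; lra.
  have := sq _ (normr_ge0 _) y1; have := sq _ (normr_ge0 _) y2.
  have : 0 < r * r by rewrite mulr_gt0.
  rewrite [(r / 2) ^+ 2]expr2 [(3 / 4 * r) ^+ 2]expr2; lra.
have Kr z' : enorm (z' - y) <= r / 4 -> enorm (z' - x) < r.
  move=> H; rewrite (_ : z' - x = (z' - y) + (y - x)); last by rewrite addrA subrK.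
  by apply: le_lt_trans (le_enormD _ _) _; lra.
have KO : [set z | enorm (z - y) <= r / 4] `<=` closure (eball x r).
  by move=> z' /= /Kr Bz'; apply: subset_closure.
apply: (cone_comparison uO _ _ _ (subset_trans KO BO)) => //; first by lra.
- by rewrite addr_ge0 ?enorm_ge0 ?mulr_ge0.
- apply: subclosed_compact cB KO.
  apply: (@preimage_closed _ _ (fun z => enorm (z - y)) [set t | t <= r / 4]).
    by move=> z' _; exact: cont_enormB.
  exact: closed_le.
move=> z' ez'.
have := uP z' (Kr _ _); rewrite ez' lexx => /(_ isT).
have := uP y; rewrite (lt_trans yx) => [/(_ isT)|]; last by lra.
rewrite !ler_norml => /andP[A _] /andP[_ B].
have := dot_le_enorm (aff_slope P) (z' - y); rewrite ez'.
have -> : dot (aff_slope P) (z' - y) = aff_eval P z' - aff_eval P y.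
  by rewrite /dot /aff_eval /dot /=; ring.
lra.
Qed.

End enorm_triangle.

(** * Smooth bumps *)

Section smooth.
Context {R : realType}.
Implicit Types (f g : R -> R).

Lemma has_deriv_near f g (x l : R) : (\forall y \near x, f y = g y) ->
  has_deriv f x l -> has_deriv g x l.
Proof. by move=> H1 H2; exact: near_eq_is_derive H1 H2. Qed.

(** At each order the derivative is a witness rather than [derive1], so that closure under sums,
    products and affine substitution goes by induction on the order. *)
Fixpoint diff_upto n f : Prop :=
  if n is k.+1 then exists2 g, (forall x, has_deriv f x (g x)) & diff_upto k g
  else True.

Definition smooth f := forall n, diff_upto n f.

Lemma diff_uptoW n f : diff_upto n.+1 f -> diff_upto n f.
Proof.
elim: n f => [//|n IH] f [g fg gn]; exists g => //; exact: IH.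
Qed.

Lemma diff_uptoD n f g : diff_upto n f -> diff_upto n g ->
  diff_upto n (fun x => f x + g x).
Proof.
elim: n f g => [//|n IH] f g [f' ff' Cf'] [g' gg' Cg'].
exists (fun x => f' x + g' x); last exact: IH.
by move=> x; exact: has_derivD.
Qed.

Lemma diff_uptoM n f g : diff_upto n f -> diff_upto n g ->
  diff_upto n (fun x => f x * g x).
Proof.
elim: n f g => [//|n IH] f g Cf Cg; case: (Cf) (Cg) => f' ff' Cf' [g' gg' Cg'].
exists (fun x => f x * g' x + g x * f' x).
  by move=> x; exact: has_derivM.
by apply: diff_uptoD; apply: IH => //; exact: diff_uptoW.
Qed.

Lemma diff_upto_cst n (c : R) : diff_upto n (fun=> c).
Proof. by elim: n c => [//|n IH] c; exists (fun=> 0) => // x; exact: has_deriv_cst. Qed.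

Lemma diff_upto_affine n f (a b : R) : diff_upto n f ->
  diff_upto n (fun x => f (a * x + b)).
Proof.
elim: n f => [//|n IH] f [f' ff' Cf'].
exists (fun x => f' (a * x + b) * a).
  move=> x; apply: (@has_deriv_comp _ f (fun x => a * x + b)); first exact: ff'.
  by derive_by_ring.
by apply: diff_uptoM; [exact: IH|exact: diff_upto_cst].
Qed.

Lemma smoothM f g : smooth f -> smooth g -> smooth (fun x => f x * g x).
Proof. by move=> Cf Cg n; exact: diff_uptoM. Qed.

Lemma smooth_affine f (a b : R) : smooth f -> smooth (fun x => f (a * x + b)).
Proof. by move=> Cf n; exact: diff_upto_affine. Qed.

Lemma smooth_deriv f : smooth f ->
  (forall x, has_deriv f x ((derive1 f) x)) /\ smooth (derive1 f).
Proof.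
move=> Cf; have [g fg _] := Cf 1.
have E h : (forall x, has_deriv f x (h x)) -> (derive1 f) = h.
  by move=> fh; apply/funext => x; rewrite derive1E; have [] := fh x.
split; first by rewrite (E _ fg).
by move=> n; have [h fh Ch] := Cf n.+1; rewrite (E _ fh).
Qed.

Lemma has_deriv_continuous f (f' x : R) : has_deriv f x f' -> {for x, continuous f}.
Proof. by move=> [df _]; apply: differentiable_continuous; apply/derivable1_diffP. Qed.

Lemma smooth_continuous f : smooth f -> continuous f.
Proof. by move=> /smooth_deriv[+ _] x => /(_ x); exact: has_deriv_continuous. Qed.

End smooth.

(** * Polynomials in 1/x times exp(-1/x) *)

Section flat_exponential.
Context {R : realType}.

(** The rate [a] is halved along the induction: one half bounds the shorter polynomial, the other
    absorbs the new factor [y], since exp(a y / 2) >= a y / 2. *)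
Lemma horner_le_expR (p : {poly R}) (a : R) : 0 < a ->
  exists2 C : R, 0 <= C & forall y : R, 0 <= y -> `|p.[y]| <= C * expR (a * y).
Proof.
elim/poly_ind: p a => [|p c IH] a a0.
  by exists 0 => // y _; rewrite horner0 normr0 mul0r.
have a2 : 0 < a / 2 by lra.
have [C C0 HC] := IH (a / 2) a2.
exists (C * (2 / a) + `|c|).
  by rewrite addr_ge0// mulr_ge0// mulr_ge0// invr_ge0 ltW.
move=> y y0; rewrite hornerMXaddC.
apply: le_trans (ler_normD _ _) _; rewrite mulrDl lerD//; last first.
  rewrite ler_peMr// (le_trans _ (expR_ge1Dx _))// lerDl mulr_ge0// ltW//.
have -> : a * y = a / 2 * y + a / 2 * y by field.
rewrite expRD normrM (ger0_norm y0); set E := expR _.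
have yE : y <= 2 / a * E.
  apply: le_trans (_ : 2 / a * (a / 2 * y) <= _).
    by rewrite le_eqVlt; apply/orP; left; apply/eqP; field; rewrite gt_eqF.
  rewrite ler_wpM2l//; first by rewrite divr_ge0// ltW.
  by apply: le_trans (expR_ge1Dx _); rewrite lerDr.
rewrite (_ : C * (2 / a) * (E * E) = C * E * (2 / a * E)); last by ring.
by rewrite ler_pM// HC.
Qed.

(** The polynomial is a parameter because differentiation sends p to X^2 (p - p'), so that the
    family is closed under it. *)
Definition flat (p : {poly R}) (x : R) : R :=
  if 0 < x then p.[x^-1] * expR (- x^-1) else 0.

(** The bound of p X^2 by an exponential, read at 1/x, leaves a factor x^2. Quadratic decay is what
    makes the difference quotient at 0 tend to 0. *)
Lemma flat_le_sqr p : exists2 C : R, 0 <= C & forall x : R, `|flat p x| <= C * x ^+ 2.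
Proof.
have [C C0 HC] := @horner_le_expR (p * 'X^2) 1 ltr01.
exists C => // x; rewrite /flat; case: ifPn => [x0|_]; last first.
  by rewrite normr0 mulr_ge0// sqr_ge0.
have := HC x^-1; rewrite invr_ge0 ltW// => /(_ isT).
rewrite mul1r hornerM hornerXn normrM.
have x2 : 0 < x ^+ 2 by rewrite exprn_gt0.
rewrite [`|x^-1 ^+ 2|]ger0_norm ?sqr_ge0// exprVn ler_pdivrMr// => H.
rewrite normrM (ger0_norm (expR_ge0 _)) expRN ler_pdivrMr ?expR_gt0//.
by rewrite (le_trans H)// mulrAC.
Qed.

Lemma has_deriv_flat p x :
  has_deriv (flat p) x (flat ('X^2 * (p - p^`())) x).
Proof.
have [x0|x0|->] := ltgtP x 0.
- rewrite {2}/flat ltNge (ltW x0)/=.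
  apply: (@has_deriv_near _ (fun=> 0)); last exact: has_deriv_cst.
  have : \forall y \near x, y < 0 by exact: lt_nbhsl.
  by apply: filterS => y y0; rewrite /flat ltNge (ltW y0).
- rewrite {2}/flat x0.
  apply: (@has_deriv_near _ (fun x => p.[x^-1] * expR (- x^-1))).
    have : \forall y \near x, 0 < y by exact: lt_nbhsr.
    by apply: filterS => y y0; rewrite /flat y0.
  have dV : has_deriv (fun x => x^-1) x (- x ^- 2).
    have := @is_deriveV R id x 1 1; rewrite gt_eqF// => /(_ isT (is_derive_id _ _)).
    by rewrite /has_deriv /GRing.scale/= mulr1.
  have dN : has_deriv (fun x => - x^-1) x (x ^- 2).
    have -> : (fun x : R => - x^-1) = fun x => -1 * x^-1.
      by apply/funext => y; rewrite mulN1r.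
    by have := has_derivM (has_deriv_cst (-1) x) dV; rewrite mulr0 addr0 mulN1r opprK.
  have dp : has_deriv (fun x => p.[x^-1]) x ((p^`()).[x^-1] * - x ^- 2).
    apply: (has_deriv_comp _ dV).
    by split; [exact: derivable_horner|rewrite -derive1E derivE].
  have de : has_deriv (fun x => expR (- x^-1)) x (expR (- x^-1) * x ^- 2).
    by apply: (has_deriv_comp _ dN); exact: is_derive_expR.
  have := has_derivM dp de; congr has_deriv.
  by rewrite hornerM hornerXn hornerD hornerN -exprVn; ring.
rewrite {2}/flat ltxx; apply/is_derive1_caratheodory.
have [C C0 HC] := flat_le_sqr p.
have F0 : flat p 0 = 0 by rewrite /flat ltxx.
(* The slope function at 0. Its value there is 0, the required derivative, as [flat p 0 = 0]; it is
   continuous there because it is at most C |z| in absolute value. *)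
exists (fun z => flat p z / z); split; last by rewrite F0 mul0r.
  move=> z; rewrite F0 !subr0.
  by have [->|z0] := eqVneq z 0; [rewrite mulr0|rewrite divfK].
rewrite /prop_for /continuous_at F0 mul0r.
apply/cvgr0Pnorm_le => e e0.
have : \forall z \near (0 : R), `|z| < e / (C + 1).
  have : 0 < e / (C + 1) by rewrite divr_gt0//; lra.
  by move/(@nbhsx_ballx _ R^o 0); apply: filterS => z; rewrite /ball/= sub0r normrN.
apply: filterS => z; rewrite ltr_pdivlMr; last by lra.
have [->|z0] := eqVneq z 0; first by rewrite invr0 mulr0 normr0 ltW.
move=> H; rewrite normrM normfV ler_pdivrMr ?normr_gt0//.
apply: le_trans (HC z) _; rewrite -real_normK ?num_real// expr2 mulrA ler_wpM2r//.
by apply: le_trans (ltW H); rewrite mulrDr mulr1 mulrC lerDl.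
Qed.

Lemma smooth_flat p : smooth (flat p).
Proof.
move=> n; elim: n p => [//|n IH] p.
by exists (flat ('X^2 * (p - p^`()))) => // x; exact: has_deriv_flat.
Qed.

End flat_exponential.

Section bump.
Context {R : realType}.
Implicit Types (f g : R -> R).

Lemma has_deriv_unique f (x a b : R) : has_deriv f x a -> has_deriv f x b -> a = b.
Proof. by move=> [_ <-] [_ <-]. Qed.

(** The complement of a closed interval is open, so [f] vanishes near [t]. *)
Lemma deriv_out_itv f (a b : R) : smooth f ->
  (forall t, t \notin `[a, b] -> f t = 0) ->
  forall t, t \notin `[a, b] -> derive1 f t = 0.
Proof.
move=> Cf f0 t tab.
apply: (@has_deriv_unique f t); first exact: (smooth_deriv Cf).1.
apply: has_deriv_near (has_deriv_cst 0 t).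
have : open [set s | s \notin `[a, b]].
  rewrite (_ : [set s | _] = ~` `[a, b]%classic); last first.
    by apply/seteqP; split=> s /= /negP.
  by apply: closed_openC; exact: itv_closed.
move=> oab; have : nbhs t [set s | s \notin `[a, b]] by apply: open_nbhs_nbhs; split.
by apply: filterS => s /f0.
Qed.

Lemma bounded_of_compact_support f (a b : R) : continuous f ->
  (forall t, t \notin `[a, b] -> f t = 0) ->
  exists2 A : R, 0 <= A & forall t, `|f t| <= A.
Proof.
move=> Cf f0; have [ab|ba] := leP a b; last first.
  exists 0 => // t; rewrite f0 ?normr0// in_itv/=; apply/negP => /andP[ta tb].
  by move: (le_trans ta tb); rewrite leNgt ba.
have [c cab maxc] := @EVT_max _ (fun t => `|f t|) a b ab
  (continuous_subspaceT (fun t => continuous_comp (Cf t) (@norm_continuous _ R^o _))).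
exists `|f c| => // t; have [/maxc//|tab] := boolP (t \in `[a, b]).
by rewrite f0// normr0.
Qed.

Definition expinv (t : R) : R := flat 1 t.

Lemma expinvE (t : R) : expinv t = if 0 < t then expR (- t^-1) else 0.
Proof. by rewrite /expinv /flat hornerC mul1r. Qed.

Lemma expinv_ge0 (t : R) : 0 <= expinv t.
Proof. by rewrite expinvE; case: ifP => // _; exact: expR_ge0. Qed.

Lemma expinv_gt0 (t : R) : 0 < t -> 0 < expinv t.
Proof. by rewrite expinvE => ->; exact: expR_gt0. Qed.

Lemma expinv_eq0 (t : R) : t <= 0 -> expinv t = 0.
Proof. by rewrite expinvE ltNge => ->. Qed.

Lemma expinv_le1 (t : R) : expinv t <= 1.
Proof.
by rewrite expinvE; case: ifP => // t0; rewrite expR_le1 oppr_le0 invr_ge0 ltW.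
Qed.

Lemma expinv_homo (s t : R) : s <= t -> expinv s <= expinv t.
Proof.
move=> st; have [s0|s0] := leP s 0; first by rewrite expinv_eq0// expinv_ge0.
have t0 := lt_le_trans s0 st.
by rewrite !expinvE s0 t0 ler_expR lerN2 lef_pV2.
Qed.

Lemma expinv_cvg1 (t : R) : 0 < t -> expinv (n.+1%:R * t) @[n --> \oo] --> (1 : R).
Proof.
move=> t0.
rewrite (_ : (fun n => _) = fun n => expR (- (harmonic n * t^-1))); last first.
  by apply/funext => n; rewrite expinvE mulr_gt0// invfM.
rewrite -[X in _ --> X](expR0 R); apply: continuous_cvg; first exact: continuous_expR.
rewrite -oppr0; apply: cvgN; rewrite -(mul0r t^-1); apply: cvgMl; exact: cvg_harmonic.
Qed.

(** With [k = 1] this is a fixed cutoff on ]a, b[; with [k = n + 1] it tends to the indicator of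
    that interval. For k > 0 and b <= a it vanishes identically, which covers empty rectangles. *)
Definition bump (a b k t : R) : R :=
  expinv (k * t + - (k * a)) * expinv (- k * t + k * b).

Lemma smooth_bump a b k : smooth (bump a b k).
Proof. by apply: smoothM; apply: smooth_affine; exact: smooth_flat. Qed.

Lemma bump_ge0 a b k t : 0 <= bump a b k t.
Proof. by rewrite mulr_ge0// expinv_ge0. Qed.

Lemma bump_le1 a b k t : bump a b k t <= 1.
Proof. by rewrite mulr_ile1// ?expinv_ge0// expinv_le1. Qed.

Lemma bump_out a b k t : 0 < k -> t \notin `]a, b[ -> bump a b k t = 0.
Proof.
move=> k0; rewrite in_itv/= negb_and -!leNgt => /orP[ta|bt].
  by rewrite /bump expinv_eq0 ?mul0r// -mulrBr mulr_ge0_le0 ?subr_le0// ltW.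
rewrite /bump [X in _ * X]expinv_eq0 ?mulr0// mulNr addrC -mulrBr.
by rewrite mulr_ge0_le0 ?subr_le0// ltW.
Qed.

Lemma bump_cvg a b t : bump a b n.+1%:R t @[n --> \oo] --> (\1_(`]a, b[%classic) t : R).
Proof.
rewrite indicE; have [|tab] := boolP (t \in _).
  rewrite inE/= in_itv/= => /andP[ta tb].
  rewrite -[X in _ --> X](mulr1 1); apply: cvgM.
    under eq_fun do rewrite -mulrBr.
    by apply: expinv_cvg1; rewrite subr_gt0.
  under eq_fun do rewrite mulNr addrC -mulrBr.
  by apply: expinv_cvg1; rewrite subr_gt0.
rewrite (_ : (fun n => _) = fun=> 0); first exact: cvg_cst.
apply/funext => n; apply: bump_out => //.
by apply: contra tab => H; rewrite inE.
Qed.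

Lemma bump_ge (w v : R) t : `|t| <= v ->
  expinv (w - v) * expinv (w - v) <= bump (- w) w 1 t.
Proof.
rewrite ler_norml => /andP[vt tv]; rewrite /bump.
by rewrite ler_pM ?expinv_ge0//; apply: expinv_homo; lra.
Qed.

End bump.

(** * Products of one-variable functions as tests *)

Section tensor.
Context {R : realType}.
Implicit Types (f g : R -> R) (Omega : set (plane R)).

Definition tens f g (z : plane R) : R := f z.1 * g z.2.

Lemma has_deriv_tens1 f g f' : (forall t, has_deriv f t (f' t)) ->
  forall z : plane R, has_deriv (fun t => tens f g (t, z.2)) z.1 (tens f' g z).
Proof.
move=> ff' z; rewrite /tens /=.
have := has_derivM (ff' z.1) (has_deriv_cst (g z.2) z.1).
by rewrite mulr0 add0r mulrC.
Qed.

Lemma has_deriv_tens2 f g g' : (forall t, has_deriv g t (g' t)) ->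
  forall z : plane R, has_deriv (fun t => tens f g (z.1, t)) z.2 (tens f g' z).
Proof.
move=> gg' z; rewrite /tens /=.
have := has_derivM (has_deriv_cst (f z.1) z.2) (gg' z.2).
by rewrite mulr0 addr0.
Qed.

Lemma d1_tens f g : smooth f -> d1 (tens f g) = tens (derive1 f) g.
Proof. by move=> /smooth_deriv[ff _]; apply: d1E; exact: has_deriv_tens1. Qed.

Lemma d2_tens f g : smooth g -> d2 (tens f g) = tens f (derive1 g).
Proof. by move=> /smooth_deriv[ff _]; apply: d2E; exact: has_deriv_tens2. Qed.

Lemma cont_tens f g : continuous f -> continuous g -> cont (tens f g).
Proof.
move=> cf cg; apply: contM => z.
  by apply: (@continuous_comp _ _ _ (fun z : plane R => z.1) f); [exact: cvg_fst|exact: cf].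
by apply: (@continuous_comp _ _ _ (fun z : plane R => z.2) g); [exact: cvg_snd|exact: cg].
Qed.

Lemma Ck_tens k f g : smooth f -> smooth g -> Ck k setT (tens f g).
Proof.
have ct f' g' : smooth f' -> smooth g' -> cont (tens f' g').
  by move=> ? ?; apply: cont_tens; exact: smooth_continuous.
elim: k f g => [|k IH] f g Cf Cg; first exact/Ck0/ct.
have [df Cf'] := smooth_deriv Cf; have [dg Cg'] := smooth_deriv Cg.
by apply: (CkS (ct _ _ Cf Cg) (has_deriv_tens1 g df) (has_deriv_tens2 f dg)); exact: IH.
Qed.

Lemma tens_out f g (a b c d : R) (z : plane R) :
  (forall t, t \notin `[a, b] -> f t = 0) ->
  (forall t, t \notin `[c, d] -> g t = 0) ->
  ~ (`[a, b] `*` `[c, d])%classic z -> tens f g z = 0.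
Proof.
move=> f0 g0 zQ; rewrite /tens; have [zab|/f0->] := boolP (z.1 \in `[a, b]);
  last by rewrite mul0r.
have [zcd|/g0->] := boolP (z.2 \in `[c, d]); last by rewrite mulr0.
by exfalso; apply: zQ; split.
Qed.

Lemma compact_rectangle (a b c d : R) :
  compact (`[a, b] `*` `[c, d] : set (plane R)).
Proof. by apply: compact_setX; exact: segment_compact. Qed.

Lemma test_function_tens Omega f g (a b c d : R) : smooth f -> smooth g ->
  (forall t, t \notin `[a, b] -> f t = 0) ->
  (forall t, t \notin `[c, d] -> g t = 0) ->
  `[a, b] `*` `[c, d] `<=` Omega -> test_function Omega (tens f g).
Proof.
move=> Cf Cg f0 g0 QO.
have sQ : closure [set z | tens f g z != 0] `<=` (`[a, b] `*` `[c, d])%classic.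
  have cQ : closed (`[a, b] `*` `[c, d] : set (plane R)).
    apply: compact_closed; last exact: compact_rectangle.
    exact: norm_hausdorff.
  rewrite [X in _ `<=` X](closure_id _).1//; apply: closure_subset => z /=.
  by apply: contra_neqP; exact: tens_out.
split; first by move=> k; exact: Ck_tens.
  apply: subclosed_compact sQ; first exact: closed_closure.
  exact: compact_rectangle.
exact: subset_trans QO.
Qed.

End tensor.

(** * Lebesgue measure in the plane *)

Section plane_measure.
Context {R : realType}.

Lemma measurable_rectangle (I J : interval R) :
  measurable ([set` I] `*` [set` J] : set (plane R)).
Proof. by apply: measurableX; exact: measurable_itv. Qed.

(** The sigma-algebra of the plane is the product one, so an open set has to be exhibited as a
    countable union of rectangles: those with rational centre and half-width 1/(n+1) that it
    contains. *)
Lemma open_measurable_plane (O : set (plane R)) : open O -> measurable O.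
Proof.
move=> oO.
pose box (p : rat * rat * nat) : set (plane R) :=
  (`]ratr p.1.1 - p.2.+1%:R^-1, ratr p.1.1 + p.2.+1%:R^-1[ `*`
   `]ratr p.1.2 - p.2.+1%:R^-1, ratr p.1.2 + p.2.+1%:R^-1[)%classic.
have -> : O = \bigcup_(p in [set p | box p `<=` O]) box p.
  apply/seteqP; split=> [z Oz|z [p /= + pz]]; last exact.
  have /nbhs_ballP[e /= e0 eO] : nbhs z O by exact: open_nbhs_nbhs.
  have [n _ ne] : exists2 n : nat, True & n.+1%:R^-1 < e / 2.
    have e2 : 0 < e / 2 by rewrite divr_gt0.
    have := @near_infty_natSinv_lt R (PosNum e2).
    by move=> [N _ /(_ N (leqnn N))]; exists N.
  have n0 : 0 < n.+1%:R^-1 :> R by rewrite invr_gt0.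
  have [k kE] : exists k : R, k = n.+1%:R^-1 by eexists.
  have rr (t : R) : exists q : rat, t - k < ratr q < t + k.
    have tt : t - k < t + k by rewrite -kE in n0; lra.
    have [q] := rat_in_itvoo tt.
    by rewrite in_itv/=; exists q.
  rewrite -kE in n0 ne.
  have [[p /andP[p1 p2]] [q /andP[q1 q2]]] := (rr z.1, rr z.2).
  exists (p, q, n); last by split; rewrite /= in_itv/= -kE; apply/andP; split; lra.
  move=> w /= [/=]; rewrite !in_itv/= -kE => /andP[w1 w2] /andP[w3 w4].
  by apply: eO; split; rewrite /ball/= ltr_norml; apply/andP; split; lra.
rewrite bigcup_mkcond; apply: countable_bigcupT_measurable; first exact: countableP.
by move=> p; case: ifPn => _ //; exact: measurable_rectangle.
Qed.

Lemma lebesgue2_rectangle (I J : interval R) :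
  lebesgue2 ([set` I] `*` [set` J])%classic
  = (@lebesgue_measure R [set` I] * @lebesgue_measure R [set` J])%E.
Proof. by apply: product_measure1E; exact: measurable_itv. Qed.

Lemma measurable_translate (c : R) :
  measurable_fun setT (fun t : measurableTypeR R => t + c : measurableTypeR R).
Proof. exact: measurable_funD. Qed.

(** Uniqueness of Lebesgue measure reduces invariance to half-open intervals; the product measure
    then inherits it from rectangles. *)
Lemma lebesgue_measure_translate (c : R) (A : set (measurableTypeR R)) : measurable A ->
  pushforward (@lebesgue_measure R)
    (fun t : measurableTypeR R => t + c : measurableTypeR R) A = lebesgue_measure A.
Proof.
move=> mA; apply/esym/lebesgue_measure_unique => //=; first exact: measurable_translate.
move=> _ _ [[a b]] _ <-; rewrite /pushforward.
rewrite (_ : _ @^-1` _ = `]a - c, b - c]%classic); last first.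
  by apply/seteqP; split=> t /=; rewrite !in_itv/= ltrBlDr lerBrDr.
by rewrite !lebesgue_measure_itv/= !lte_fin ltrD2r -!EFinB;
  congr (if _ then _%:E else _); ring.
Qed.

Lemma measurable_translate2 (v : plane R) :
  measurable_fun setT (fun z : plane R => z + v : plane R).
Proof.
apply: measurable_fun_pair.
  apply: (measurableT_comp (measurable_translate v.1)); exact: measurable_fst.
apply: (measurableT_comp (measurable_translate v.2)); exact: measurable_snd.
Qed.

Lemma lebesgue2_translate (v : plane R) (A : set (plane R)) : measurable A ->
  pushforward lebesgue2 (fun z : plane R => z + v : plane R) A = lebesgue2 A.
Proof.
move=> mA; apply/esym/product_measure_unique => //=; first exact: measurable_translate2.
move=> _ B C mB mC; rewrite /pushforward.
rewrite (_ : _ @^-1` _ =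
  ((fun t : measurableTypeR R => t + v.1 : measurableTypeR R) @^-1` B) `*`
   ((fun t : measurableTypeR R => t + v.2 : measurableTypeR R) @^-1` C))//.
have mT (w : R) (D : set (measurableTypeR R)) : measurable D ->
  measurable ((fun t : measurableTypeR R => t + w : measurableTypeR R) @^-1` D).
  by move=> mD; rewrite -[X in measurable X]setTI; exact: measurable_translate.
rewrite [LHS]product_measure1E; [|exact: mT|exact: mT].
by congr (_ * _)%E; exact: lebesgue_measure_translate.
Qed.

Lemma ge0_integral_translate (v : plane R) (f : plane R -> \bar R) :
  measurable_fun setT f -> (forall z, 0 <= f z)%E ->
  (\int[lebesgue2]_z f (z + v)%R = \int[lebesgue2]_z f z)%E.
Proof.
move=> mf f0.
pose T := fun z : plane R => (z + v)%R : plane R.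
have H := @ge0_integral_pushforward _ _ _ _ R T (measurable_translate2 v) lebesgue2 setT f
  measurableT mf (fun z _ => f0 z).
rewrite preimage_setT in H; apply: etrans (esym H) _.
apply: eq_measure_integral; first exact: measurable_translate2.
by move=> ? A mA _; exact: (lebesgue2_translate v mA).
Qed.

End plane_measure.

(** * Real-valued integrals over the plane *)

Section real_integrals.
Context {R : realType}.
Local Notation plane := (plane R).
Implicit Types (f g h : plane -> R).

Definition integ f := lebesgue2.-integrable setT (EFin \o f).
(** [Rintegral] passes through [fine], which sends infinite values to 0; the integrability
    hypotheses below keep the calculus meaningful. *)
Definition pint f : R := \int[lebesgue2]_z f z.

Lemma integ_measurable f : integ f -> measurable_fun setT f.
Proof. by move=> /measurable_int/measurable_EFinP. Qed.

Lemma integ_le f g : measurable_fun setT f -> integ g ->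
  (forall z, `|f z| <= g z) -> integ f.
Proof.
move=> mf ig fg; apply: le_integrable ig => //; first exact/measurable_EFinP.
by move=> z _ /=; rewrite lee_fin (le_trans (fg z))// ler_norm.
Qed.

Lemma integD f g : integ f -> integ g -> integ (fun z => f z + g z).
Proof. by move=> If Ig; have := integrableD measurableT If Ig. Qed.

Lemma integZ (k : R) f : integ f -> integ (fun z => k * f z).
Proof. by move=> If; have := integrableZl measurableT k If. Qed.

Lemma integN f : integ f -> integ (fun z => - f z).
Proof. by move=> If; have := integrableN If. Qed.

Lemma integB f g : integ f -> integ g -> integ (fun z => f z - g z).
Proof. by move=> If Ig; apply: integD => //; exact: integN. Qed.

Lemma integ_norm f : integ f -> integ (fun z => `|f z|).
Proof. by move=> If; have := integrable_abse If. Qed.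

Lemma integM f g (k : R) : integ f -> measurable_fun setT g ->
  (forall z, `|g z| <= k) -> integ (fun z => f z * g z).
Proof.
move=> If mg gk; apply: (@integ_le _ (fun z => k * `|f z|)).
- by apply: measurable_funM => //; exact: integ_measurable.
- exact/integZ/integ_norm.
by move=> z; rewrite normrM mulrC ler_wpM2r.
Qed.

Lemma pintD f g : integ f -> integ g -> pint (fun z => f z + g z) = pint f + pint g.
Proof. by move=> If Ig; rewrite /pint RintegralD. Qed.

Lemma pintB f g : integ f -> integ g -> pint (fun z => f z - g z) = pint f - pint g.
Proof. by move=> If Ig; rewrite /pint RintegralB. Qed.

Lemma pintZ (k : R) f : integ f -> pint (fun z => k * f z) = k * pint f.
Proof. by move=> If; rewrite /pint RintegralZl. Qed.

Lemma pintN f : integ f -> pint (fun z => - f z) = - pint f.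
Proof.
move=> If; rewrite -mulN1r -pintZ//; congr (pint _).
by apply/funext => z; rewrite mulN1r.
Qed.

Lemma pint_le f g : integ f -> integ g -> (forall z, f z <= g z) -> pint f <= pint g.
Proof. by move=> If Ig fg; apply: le_Rintegral. Qed.

Lemma pint_dominated (f_ : nat -> plane -> R) f h :
  (forall n, measurable_fun setT (f_ n)) -> measurable_fun setT f ->
  (forall z, f_ n z @[n --> \oo] --> f z) ->
  integ h -> (forall n z, `|f_ n z| <= h z) ->
  pint (f_ n) @[n --> \oo] --> pint f.
Proof.
move=> mf_ mf cf Ih fh.
have [] := @dominated_convergence _ _ _ lebesgue2 setT measurableT
  (fun n => EFin \o f_ n) (EFin \o f) (EFin \o h).
- by move=> n; exact/measurable_EFinP.
- exact/measurable_EFinP.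
- by apply: aeW => z _ /=; apply: cvg_EFin; [exact: nearW|exact: cf].
- exact: Ih.
- by apply: aeW => z n _ /=; rewrite lee_fin.
move=> If _ H; apply: fine_cvg.
by rewrite fineK; [exact: H|exact: (integrable_fin_num measurableT If)].
Qed.

Lemma integ_translate (v : plane) f : integ f -> integ (fun z => f (z + v)).
Proof.
move=> /integrableP[mf fi]; apply/integrableP; split.
  exact: (measurableT_comp mf (measurable_translate2 v)).
have mn : measurable_fun setT (fun z => `|(f z)%:E|)%E by exact: measurableT_comp.
by have := @ge0_integral_translate R v _ mn (fun z => abse_ge0 _) => /= ->.
Qed.

Lemma pint_translate (v : plane) f : integ f -> pint (fun z => f (z + v)) = pint f.
Proof.
move=> If; rewrite /pint /Rintegral; congr fine.
have mf : measurable_fun setT (EFin \o f) by exact: measurable_int If.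
rewrite integralE [RHS]integralE.
congr (_ - _)%E.
  have := @ge0_integral_translate R v _ (measurable_funepos mf) (fun z => funepos_ge0 _ z).
  by move=> H; apply: (etrans _ H); apply: eq_integral => z _; rewrite ?funeposE ?funenegE.
have := @ge0_integral_translate R v _ (measurable_funeneg mf) (fun z => funeneg_ge0 _ z).
by move=> H; apply: (etrans _ H); apply: eq_integral => z _; rewrite ?funeposE ?funenegE.
Qed.

End real_integrals.

(** * Difference quotients against tests *)

Section difference_quotient.
Context {R : realType}.
Implicit Types (f g : R -> R).

Lemma has_deriv_seq f (l : R) : has_deriv f 0 l ->
  n.+1%:R * (f n.+1%:R^-1 - f 0) @[n --> \oo] --> l.
Proof.
move=> /is_derive1_caratheodory[g [fg cg <-]].
rewrite (_ : (fun n => _) = g \o (@harmonic R)); last first.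
  by apply/funext => n; rewrite fg subr0 /= mulrCA divff ?mulr1.
by apply: continuous_cvg; [exact: cg|exact: cvg_harmonic].
Qed.

Lemma deriv_bound_increment f k (L : R) : (forall t, has_deriv f t (k t)) ->
  (forall t, `|k t| <= L) -> forall t, 0 < t -> `|f t - f 0| <= L * t.
Proof.
move=> fk kL t t0.
have [||c _ ->] := @MVT _ f k 0 t t0.
- by move=> x _; exact: fk.
- by apply: continuous_subspaceT => x; exact: has_deriv_continuous (fk x).
by rewrite subr0 normrM (gtr0_norm t0) ler_pM2r.
Qed.

Lemma measurable_tens f g : continuous f -> continuous g ->
  measurable_fun setT (tens f g).
Proof.
move=> cf cg; apply: measurable_funM.
  by apply: (measurableT_comp (continuous_measurable_fun cf)); exact: measurable_fst.
by apply: (measurableT_comp (continuous_measurable_fun cg)); exact: measurable_snd.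
Qed.

(** The directional derivative of [tens f g] along [e]. *)
Definition dtens f g (e : plane R) (z : plane R) : R :=
  e.1 * tens (derive1 f) g z + e.2 * tens f (derive1 g) z.

Section tens_increments.
Variables (f g : R -> R) (a b c d : R).
Hypotheses (sf : smooth f) (sg : smooth g).
Hypotheses (f0 : forall t, t \notin `[a, b] -> f t = 0)
           (g0 : forall t, t \notin `[c, d] -> g t = 0).

Lemma measurable_dtens e : measurable_fun setT (dtens f g e).
Proof.
have [_ sf'] := smooth_deriv sf; have [_ sg'] := smooth_deriv sg.
by apply: measurable_funD; apply: measurable_funM => //;
  apply: measurable_tens; exact: smooth_continuous.
Qed.

Lemma tens_bounded : exists2 A : R, 0 <= A & forall z, `|tens f g z| <= A.
Proof.
have [A A0 fA] := bounded_of_compact_support (smooth_continuous sf) f0.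
have [B B0 gB] := bounded_of_compact_support (smooth_continuous sg) g0.
exists (A * B); first exact: mulr_ge0.
by move=> z; rewrite normrM ler_pM.
Qed.

Lemma has_deriv_tens_line (z e : plane R) t :
  has_deriv (fun t => tens f g (z + t *: e)) t (dtens f g e (z + t *: e)).
Proof.
have [df _] := smooth_deriv sf; have [dg _] := smooth_deriv sg.
have l1 (w v : R) : has_deriv (fun t => w + t * v) t v by derive_by_ring.
have := has_derivM (has_deriv_comp (df _) (l1 z.1 e.1)) (has_deriv_comp (dg _) (l1 z.2
  e.2)).
rewrite /tens /dtens /tens /=; congr has_deriv; rewrite /GRing.scale/=; ring.
Qed.

End tens_increments.

Lemma dtens_bounded f g a b c d e : smooth f -> smooth g ->
  (forall t, t \notin `[a, b] -> f t = 0) -> (forall t, t \notin `[c, d] -> g t = 0) ->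
  exists2 A : R, 0 <= A & forall z, `|dtens f g e z| <= A.
Proof.
move=> sf sg f0 g0.
have [_ sf'] := smooth_deriv sf; have [_ sg'] := smooth_deriv sg.
have [A A0 HA] := tens_bounded sf' sg (deriv_out_itv sf f0) g0.
have [B B0 HB] := tens_bounded sf sg' f0 (deriv_out_itv sg g0).
exists (`|e.1| * A + `|e.2| * B); first by rewrite addr_ge0// mulr_ge0.
move=> z; apply: le_trans (ler_normD _ _) _.
by rewrite lerD// normrM ler_wpM2l.
Qed.

(** A discrete integration by parts: translating the integral turns the backward quotient of [u]
    into the forward quotient [q n] of the test, up to sign. The quotients of the test converge
    pointwise and are bounded by [L], a bound of its directional derivative, so L |u| dominates. *)
Lemma diff_quotient_cvg (u : plane R -> R) f g a b c d (e : plane R) : integ u ->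
  smooth f -> smooth g ->
  (forall t, t \notin `[a, b] -> f t = 0) -> (forall t, t \notin `[c, d] -> g t = 0) ->
  pint (fun z : plane R => n.+1%:R * (u z - u (z - n.+1%:R^-1 *: e)) * tens f g z) @[n
    --> \oo]
    --> - pint (fun z : plane R => u z * dtens f g e z).
Proof.
move=> Iu sf sg f0 g0.
have mt : measurable_fun setT (tens f g) by apply: measurable_tens;
  exact: smooth_continuous.
have [A A0 tA] := tens_bounded sf sg f0 g0.
have [L L0 dL] := dtens_bounded e sf sg f0 g0.
have mts (v : plane R) : measurable_fun setT (fun z : plane R => tens f g (z + v)).
  by apply: (measurableT_comp mt); exact: measurable_translate2.
pose q n (z : plane R) : R := n.+1%:R * (tens f g (z + n.+1%:R^-1 *: e) - tens f g z).
have E n : pint (fun z : plane R => n.+1%:R * (u z - u (z - n.+1%:R^-1 *: e)) * tens f g z)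
    = - pint (fun z : plane R => u z * q n z).
  set v := n.+1%:R^-1 *: e.
  have I1 : integ (fun z : plane R => u z * tens f g z) by exact: integM tA.
  have I2 : integ (fun z : plane R => u z * tens f g (z + v)) by apply: (integM (k := A)).
  have I3 : integ (fun z : plane R => u (z - v) * tens f g z).
    by apply: (integM (k := A)) => //; exact: integ_translate.
  transitivity (n.+1%:R * (pint (fun z : plane R => u z * tens f g z) - pint (fun z :
    plane R => u (z - v) * tens f g z))).
    rewrite -pintB// -pintZ; last exact: integB.
    by congr pint; apply/funext => z; rewrite -mulrA mulrBl.
  have -> : pint (fun z : plane R => u (z - v) * tens f g z) =
    pint (fun z : plane R => u z * tens f g (z + v)).
    rewrite -(pint_translate v I3); congr pint; apply/funext => z.
    by rewrite addrK.
  have -> : (fun z : plane R => u z * q n z) =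
      fun z => n.+1%:R * (u z * tens f g (z + v) - u z * tens f g z).
    by apply/funext => z; rewrite /q -/v mulrCA mulrBr.
  by rewrite pintZ ?pintB//; [ring|exact: integB].
rewrite (_ : (fun n => _) = fun n => - pint (fun z : plane R => u z * q n z));
  last exact/funext.
have mq n : measurable_fun setT (q n).
  apply: measurable_funM => //; apply: measurable_funB => //; exact: mts.
have mu : measurable_fun setT u by exact: integ_measurable.
apply: cvgN; apply: (@pint_dominated _ _ _ (fun z => L * `|u z|)).
- by move=> n; apply: measurable_funM.
- by apply: measurable_funM => //; exact: measurable_dtens.
- move=> z; apply: cvgMr.
  have := has_deriv_seq (has_deriv_tens_line sf sg z e 0).
  by rewrite scale0r addr0.
- exact/integZ/integ_norm.
move=> n z; rewrite normrM mulrC ler_wpM2r// /q.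
have n0 : 0 < n.+1%:R^-1 :> R by rewrite invr_gt0.
have := deriv_bound_increment (has_deriv_tens_line sf sg z e) (fun t => dL _) n0.
rewrite scale0r addr0 normrM (gtr0_norm (ltr0Sn _ _)) => H.
by rewrite mulrC -ler_pdivlMr.
Qed.

Lemma integ_rectangle (a b c d : R) :
  integ (\1_(`[a, b] `*` `[c, d])%classic : plane R -> R).
Proof.
have mQ : measurable (`[a, b] `*` `[c, d] : set (plane R))%classic.
  exact: measurable_rectangle.
apply/integrableP; split; first by apply/measurable_EFinP; exact: measurable_indic.
under eq_integral do rewrite /= ger0_norm//.
rewrite integral_indic// setIT lebesgue2_rectangle !lebesgue_measure_itv/=.
by do 2 case: ifP => _; rewrite ?mul0e ?mule0 ?ltry// -!EFinB -EFinM ltry.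
Qed.

Lemma integ_bounded_support (f : plane R -> R) (a b c d k : R) :
  measurable_fun setT f -> (forall z, `|f z| <= k) ->
  (forall z, ~ (`[a, b] `*` `[c, d])%classic z -> f z = 0) -> integ f.
Proof.
move=> mf fk f0; apply: (integ_le mf (integZ k (integ_rectangle a b c d))) => z.
rewrite indicE; have [zQ|zQ] := boolP (z \in _); first by rewrite mulr1.
by rewrite f0 ?normr0 ?mulr0//; move: zQ => /negP; rewrite inE.
Qed.

Lemma integ_tens f g a b c d : smooth f -> smooth g ->
  (forall t, t \notin `[a, b] -> f t = 0) -> (forall t, t \notin `[c, d] -> g t = 0) ->
  integ (tens f g).
Proof.
move=> sf sg f0 g0; have [A A0 tA] := tens_bounded sf sg f0 g0.
apply: (@integ_bounded_support _ a b c d A) => //.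
  by apply: measurable_tens; exact: smooth_continuous.
by move=> z; exact: tens_out.
Qed.

(** For small steps the difference quotient is at most [M] wherever the test is nonzero, and the
    bound survives the limit. When [u] has a weak gradient, the left-hand side is the pairing of the
    test with its component along [e]. *)
Lemma diff_quotient_le (u : plane R -> R) f g a b c d (e : plane R) (M t0 : R) :
  integ u -> smooth f -> smooth g ->
  (forall t, t \notin `[a, b] -> f t = 0) -> (forall t, t \notin `[c, d] -> g t = 0) ->
  (forall z, 0 <= tens f g z) -> 0 < t0 ->
  (forall z t, tens f g z != 0 -> 0 < t < t0 -> u z - u (z - t *: e) <= M * t) ->
  - pint (fun z : plane R => u z * dtens f g e z) <= M * pint (tens f g).
Proof.
move=> Iu sf sg f0 g0 fg0 t00 uM.
have mt : measurable_fun setT (tens f g) by apply: measurable_tens;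
  exact: smooth_continuous.
have [A A0 tA] := tens_bounded sf sg f0 g0.
have It := integ_tens sf sg f0 g0.
have H := diff_quotient_cvg (e := e) Iu sf sg f0 g0; refine (cvgr_to_le H _).
have [N _ HN] := @near_infty_natSinv_lt R (PosNum t00).
exists N => // n /HN /= nt; rewrite -pintZ//; apply: pint_le => [||z].
- apply: (integM (k := A)) => //; apply: integZ; apply: integB => //.
  exact: integ_translate.
- exact: integZ.
have [->|tz] := eqVneq (tens f g z) 0; first by rewrite !mulr0.
rewrite ler_wpM2r//.
have n0 : 0 < n.+1%:R^-1 :> R by rewrite invr_gt0.
have := uM z n.+1%:R^-1 tz; rewrite n0 nt => /(_ isT).
by rewrite ler_pdivlMr// mulrC.
Qed.

(** Meant for affine functions cut off away from the support of the test: their quotients are exact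
    once the step is small, so the limit is an integration by parts. *)
Lemma diff_quotient_eq (u : plane R -> R) f g a b c d (e : plane R) (M t0 : R) :
  integ u -> smooth f -> smooth g ->
  (forall t, t \notin `[a, b] -> f t = 0) -> (forall t, t \notin `[c, d] -> g t = 0) ->
  0 < t0 ->
  (forall z t, tens f g z != 0 -> 0 < t < t0 -> u z - u (z - t *: e) = M * t) ->
  pint (fun z : plane R => u z * dtens f g e z) = - (M * pint (tens f g)).
Proof.
move=> Iu sf sg f0 g0 t00 uM.
have It := integ_tens sf sg f0 g0.
apply: oppr_inj; rewrite opprK.
apply: (cvg_unique _ (diff_quotient_cvg (e := e) Iu sf sg f0 g0)) => //.
apply: cvg_near_cst.
have [N _ HN] := @near_infty_natSinv_lt R (PosNum t00).
exists N => // n /HN /= nt; rewrite -pintZ//; congr pint; apply/funext => z.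
have [->|tz] := eqVneq (tens f g z) 0; first by rewrite !mulr0.
have n0 : 0 < n.+1%:R^-1 :> R by rewrite invr_gt0.
by rewrite uM ?n0//; congr (_ * _); rewrite mulrCA divff ?mulr1.
Qed.

End difference_quotient.

(** * The fundamental lemma of the calculus of variations *)

Lemma ae_forall_countable d (T : measurableType d) (R : realType)
    (mu : {measure set T -> \bar R}) (I : countType) (P : I -> T -> Prop) :
  (forall i, \forall x \ae mu, P i x) -> \forall x \ae mu, forall i, P i x.
Proof.
move=> aeP.
pose F n := if @unpickle I n is Some i then ~` [set x | P i x] else set0.
have : mu.-negligible (\bigcup_n F n).
  apply: negligible_bigcup => n; rewrite /F.
  by case: unpickle => [i|]; [exact: aeP|exact: negligible_set0].
apply: negligibleS => x /= /existsNP[i nPi].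
by exists (pickle i) => //; rewrite /F pickleK.
Qed.

Lemma ae_impl d (T : measurableType d) (R : realType)
    (mu : {measure set T -> \bar R}) (P Q : T -> Prop) :
  (forall x, P x -> Q x) -> (\forall x \ae mu, P x) -> \forall x \ae mu, Q x.
Proof. by move=> PQ; apply: filterS. Qed.

Section nonnegative_from_intervals.
Context {R : realType}.
Local Notation mu := (@lebesgue_measure R).

(** At almost every point the primitive [F] is differentiable with derivative [f]. The hypothesis
    makes [F] nondecreasing along the rationals, whereas [f x < 0] would force F q < F x < F p for
    rationals p < x < q close to x. *)
Lemma ae_ge0_of_intervals (f : R -> R) :
  mu.-integrable setT (EFin \o f) ->
  (forall p q : rat, (p < q)%R -> 0 <= \int[mu]_(t in `]ratr p, ratr q]) f t) ->
  \forall x \ae mu, 0 <= f x.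
Proof.
move=> If f0.
have Isub (i : interval R) : mu.-integrable [set` i] (EFin \o f).
  by apply: integrableS If => //; exact: measurable_itv.
have := FTC1Ny (fun y => Isub `]-oo, y]) (open_integrable_locally openT If).
pose F x := \int[mu]_(t in `]-oo, x]) f t.
rewrite -/F; apply: ae_impl => x [dF Fx].
rewrite leNgt; apply/negP => fx0.
have Fpq (p q : rat) : p < q -> F (ratr p) <= F (ratr q).
  move=> pq; rewrite -subr_ge0 /F Rintegral_itvB//; first exact: f0.
  by rewrite bnd_simp ler_rat ltW.
have dFx : 'D_1 F x = f x by rewrite -derive1E.
have := DeriveDef dF dFx.
move=> /is_derive1_caratheodory[g [Fg cg gx]].
have : \forall y \near x, g y < 0.
  have := cg [set t | t < 0]; apply; rewrite gx; exact: lt_nbhsl.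
move=> /nbhs_ballP[e /= e0 He].
have [q] := @rat_in_itvoo _ x (x + e) (ltac:(rewrite ltrDl//)).
rewrite in_itv/= => /andP[xq qe].
have [p] := @rat_in_itvoo _ (x - e) x (ltac:(rewrite ltrBlDr ltrDl//)).
rewrite in_itv/= => /andP[pe px].
have := Fpq p q; rewrite -(@ltr_rat R) (lt_trans px xq) => /(_ isT).
have gq : g (ratr q) < 0 by apply: He; rewrite /ball/= ltr_norml; apply/andP; split; lra.
have gp : g (ratr p) < 0 by apply: He; rewrite /ball/= ltr_norml; apply/andP; split; lra.
rewrite leNgt => /negP; apply.
have : F (ratr q) < F x.
  by rewrite -subr_lt0 Fg nmulr_rlt0// subr_gt0.
move/lt_trans; apply.
by rewrite -subr_gt0 Fg nmulr_rgt0// subr_lt0.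
Qed.

End nonnegative_from_intervals.

Section rectangles.
Context {R : realType}.
Local Notation mu := (@lebesgue_measure R).

Lemma integral_indicM (D : set R) (f : R -> R) :
  (\int[mu]_(t in D) (f t)%:E = \int[mu]_t (\1_D t * f t)%:E)%E.
Proof.
rewrite integral_mkcond; apply: eq_integral => t _; rewrite /patch indicE.
by case: (t \in D); rewrite ?mul1r ?mul0r.
Qed.

Lemma integrable_indicM (D : set R) (f : R -> R) : measurable D ->
  mu.-integrable setT (EFin \o f) ->
  mu.-integrable setT (EFin \o (fun t => \1_D t * f t)).
Proof.
move=> mD If; apply: (le_integrable _ _ _ If) => //.
  apply/measurable_EFinP/measurable_funM; first exact: measurable_indic.
  by apply/measurable_EFinP; exact: measurable_int If.
move=> t _ /=; rewrite lee_fin normrM indicE.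
by case: (t \in D); rewrite ?normr1 ?mul1r ?normr0 ?mul0r.
Qed.

(** Primitives involve half-open intervals and limits of bumps open ones; the endpoint is a null
    set. *)
Lemma Rintegral_itvoc_indicM (a b : R) (f : R -> R) :
  mu.-integrable setT (EFin \o f) ->
  \int[mu]_(t in `]a, b]) f t = \int[mu]_t (\1_(`]a, b[%classic) t * f t).
Proof.
move=> If; rewrite -Rintegral_itv_bndo_bndc.
  by rewrite /Rintegral integral_indicM.
by apply: integrableS If => //; exact: measurable_itv.
Qed.

Lemma integrable_fine (F : R -> \bar R) : mu.-integrable setT F ->
  mu.-integrable setT (EFin \o (fine \o F)) /\ ae_eq mu setT (EFin \o (fine \o F)) F.
Proof.
move=> IF; split.
  apply: (le_integrable _ _ _ IF) => //.
    apply/measurable_EFinP; apply: measurableT_comp; first exact: fine_measurable.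
    exact: measurable_int IF.
  by move=> t _ /=; case: (F t) => [r||] //=; rewrite ?leey// normr0 ?leey.
have := integrable_ae measurableT IF; apply: ae_impl => x Fx _ /=.
by rewrite fineK// Fx.
Qed.

(** Fubini reduces to one variable twice. For rational c < d the integral of [f] over ]c, d[ in the
    second variable is nonnegative for almost every x; outside one null set this holds for all
    rational c < d together, and then the section of [f] at x is nonnegative almost everywhere. So
    almost every section of the set where f < 0 is null. *)
Lemma ae_ge0_of_rectangles (f : plane R -> R) : integ f ->
  (forall a b c d : rat, a < b -> c < d ->
    0 <= pint (fun z : plane R => \1_(`]ratr a, ratr b[%classic) z.1
              * (\1_(`]ratr c, ratr d[%classic) z.2 * f z))) ->
  \forall z \ae lebesgue2, 0 <= f z.
Proof.
move=> If f0.
have mf := integ_measurable If.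
have m1 (i : interval R) : measurable_fun setT (\1_[set` i] : measurableTypeR R -> R).
  exact: measurable_indic.
have mJ (i : interval R) : measurable_fun setT (fun z : plane R => \1_[set` i] z.2 : R).
  apply: (measurableT_comp (m1 i)).
  exact: measurable_snd.
have mI (i : interval R) : measurable_fun setT (fun z : plane R => \1_[set` i] z.1 : R).
  apply: (measurableT_comp (m1 i)).
  exact: measurable_fst.
have i1 (D : set R) x : `|\1_D x| <= 1 :> R.
  by rewrite indicE; case: (_ \in _); rewrite ?normr1// normr0.
pose h (c d : rat) (z : plane R) := \1_(`]ratr c, ratr d[%classic) z.2 * f z.
have Ih c d : integ (h c d).
  rewrite (_ : h c d = fun z => f z * \1_(`]ratr c, ratr d[%classic) z.2); last first.
    by apply/funext => z; rewrite mulrC.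
  by apply: (integM (k := 1)).
pose Phi c d := fubini_F mu (EFin \o h c d).
have IPhi c d : mu.-integrable setT (Phi c d) by exact: integrable_fubini_F (Ih c d).
(* The inner integral is extended-real valued; [fine] changes it on a null set only, so its
   integrals over intervals are unaffected. *)
have Phi0 c d : c < d -> \forall x \ae mu, 0 <= fine (Phi c d x).
  move=> cd; have [Ifine aefine] := integrable_fine (IPhi c d).
  apply: (@ae_ge0_of_intervals _ (fine \o Phi c d)) => // a b ab.
  rewrite Rintegral_itvoc_indicM//; apply: le_trans (f0 a b c d ab cd) _.
  rewrite le_eqVlt; apply/orP; left; apply/eqP.
  rewrite /pint /Rintegral; congr fine.
  pose k z := \1_(`]ratr a, ratr b[%classic) z.1 * h c d z.
  have Ik : integ k.
    rewrite (_ : k = fun z => h c d z * \1_(`]ratr a, ratr b[%classic) z.1); last first.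
      by apply/funext => z; rewrite mulrC.
    by apply: (integM (k := 1)).
  rewrite -[LHS](integral12_prod_meas1 Ik).
  apply: ae_eq_integral => //.
  - exact: measurable_int (integrable_fubini_F Ik).
  - by apply: measurable_int (integrable_indicM _ Ifine); exact: measurable_itv.
  apply: ae_impl aefine => x /(_ Logic.I) /= xE _.
  rewrite /fubini_F /k /= EFinM xE /Phi /fubini_F /=.
  rewrite indicE; case: (x \in _); last first.
    by rewrite mul0e; apply: integral0_eq => y _; rewrite mul0r.
  by rewrite mul1e; apply: eq_integral => y _; rewrite mul1r.
have aePhi : \forall x \ae mu, forall cd : rat * rat, cd.1 < cd.2 ->
  0 <= fine (Phi cd.1 cd.2 x).
  apply: ae_forall_countable => -[c d] /=.
  have [cd|dc] := boolP (c < d); last by apply: aeW.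
  by apply: ae_impl (Phi0 _ _ cd).
have aeint := ae_integrable1 If.
pose A := [set z | f z < 0].
have mA : measurable A.
  rewrite (_ : A = f @^-1` `]-oo, 0[%classic).
    by rewrite -[X in measurable X]setTI; apply: mf => //; exact: measurable_itv.
  by apply/seteqP; split=> z /=; rewrite in_itv.
have aesec : \forall x \ae mu, mu (xsection A x) = 0.
  have : \forall x \ae mu, (forall cd : rat * rat, cd.1 < cd.2 ->
    0 <= fine (Phi cd.1 cd.2 x))
      /\ mu.-integrable setT (fun y => (f (x, y))%:E).
    by apply: filterI.
  apply: ae_impl => x [Px Ix].
  have : \forall y \ae mu, 0 <= f (x, y).
    apply: (@ae_ge0_of_intervals _ (fun y => f (x, y))) => // c d cd.
    by rewrite Rintegral_itvoc_indicM//; exact: (Px (c, d) cd).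
  move=> [N [mN N0 HN]]; apply: (@subset_measure0 _ _ _ mu _ N) => //.
    exact: measurable_xsection.
  move=> y; rewrite /xsection/= inE => Ay; apply: HN => /=.
  by apply/negP; rewrite -ltNge.
have A0 : lebesgue2 A = 0.
  rewrite -[LHS]/(\int[mu]_x (mu \o xsection A) x)%E.
  transitivity (\int[mu]_x (cst 0%E) x)%E; last by rewrite integral0.
  apply: ae_eq_integral => //; first exact: measurable_fun_xsection.
  by apply: ae_impl aesec => x /= ->.
exists A; split => // z /= /negP; rewrite -ltNge.
exact.
Qed.

End rectangles.

(** * The energy estimate *)

Section affine.
Context {R : realType}.
Implicit Types (f g : R -> R).

Lemma dtens10 f g : dtens f g (1, 0) = tens (derive1 f) g.
Proof. by apply/funext => z; rewrite /dtens /= mul1r mul0r addr0. Qed.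

Lemma dtens01 f g : dtens f g (0, 1) = tens f (derive1 g).
Proof. by apply/funext => z; rewrite /dtens /= mul1r mul0r add0r. Qed.

Lemma measurable_affine (P : @affine_fun R) : measurable_fun setT (aff_eval P).
Proof.
apply: measurable_funD => //; apply: measurable_funD; exact: measurable_funM.
Qed.

Lemma affine_bounded_rectangle (P : @affine_fun R) (a b c d : R) :
  exists k, forall z : plane R, (`[a, b] `*` `[c, d])%classic z -> `|aff_eval P z| <= k.
Proof.
exists (`|aff_const P| + (`|(aff_slope P).1| * (`|a| + `|b|) +
  `|(aff_slope P).2| * (`|c| + `|d|))).
have H (s t w : R) : w \in `[s, t] -> `|w| <= `|s| + `|t|.
  rewrite in_itv/= => /andP[sw wt]; rewrite ler_norml; apply/andP; split.
    by have := ler_norm (- s); rewrite normrN; have := normr_ge0 t; lra.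
  by have := ler_norm t; have := normr_ge0 s; lra.
move=> z [/= z1 z2]; rewrite /aff_eval /dot.
apply: le_trans (ler_normD _ _) _; rewrite lerD//.
apply: le_trans (ler_normD _ _) _; rewrite !normrM lerD// ler_wpM2l//; exact: H.
Qed.

Lemma pint_affine_dtens (P : @affine_fun R) f g (a b c d : R) (e : plane R) :
  smooth f -> smooth g ->
  (forall t, t \notin `[a, b] -> f t = 0) -> (forall t, t \notin `[c, d] -> g t = 0) ->
  `|e.1| <= 1 -> `|e.2| <= 1 ->
  pint (fun z : plane R => aff_eval P z * dtens f g e z) =
    - (dot (aff_slope P) e * pint (tens f g)).
Proof.
move=> sf sg f0 g0 e1 e2.
(* The affine function is cut off to become integrable. The margin 1 keeps [z - t *: e] in [Q] for 0
   < t < 1 whenever the test is nonzero at [z]. *)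
set Q := (`[a - 1, b + 1] `*` `[c - 1, d + 1])%classic : set (plane R).
have mQ : measurable Q by exact: measurable_rectangle.
pose u (z : plane R) := aff_eval P z * \1_Q z.
have Iu : integ u.
  have [k Pk] := affine_bounded_rectangle P (a - 1) (b + 1) (c - 1) (d + 1).
  apply: (@integ_bounded_support _ _ (a - 1) (b + 1) (c - 1) (d + 1) (Num.max k 0)).
  - by apply: measurable_funM; [exact: measurable_affine|exact: measurable_indic].
  - move=> z; rewrite /u indicE; have [|_] := boolP (z \in Q).
      by rewrite inE => /Pk zk; rewrite mulr1 le_max zk.
    by rewrite mulr0 normr0 le_max lexx orbT.
  - by move=> z zQ; rewrite /u indicE memNset// mulr0.
have inQ (z : plane R) : tens f g z != 0 -> `[a, b]%classic z.1 /\ `[c, d]%classic z.2.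
  move=> tz; split.
    by apply/negP => /negP/f0 f0z; move: tz; rewrite /tens f0z mul0r eqxx.
  by apply/negP => /negP/g0 g0z; move: tz; rewrite /tens g0z mulr0 eqxx.
rewrite -(@diff_quotient_eq _ u f g a b c d e (dot (aff_slope P) e) 1 Iu sf sg f0 g0)//.
  congr pint; apply/funext => z; rewrite /u indicE; have [zQ|zQ] := boolP (z \in Q).
    by rewrite mulr1.
  have zr : ~ (`[a, b] `*` `[c, d])%classic z.
    move=> [/=]; rewrite !in_itv/= => /andP[? ?] /andP[? ?].
    move: zQ => /negP; apply; rewrite inE; split => /=; rewrite in_itv/=; lra.
  have [_ sf'] := smooth_deriv sf; have [_ sg'] := smooth_deriv sg.
  rewrite /dtens (tens_out (deriv_out_itv sf f0) g0 zr).
  by rewrite (tens_out f0 (deriv_out_itv sg g0) zr) !mulr0 addr0 !mulr0.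
move=> z t /inQ[/=]; rewrite !in_itv/= => /andP[? ?] /andP[? ?] /andP[t0 t1].
have te (w : R) : `|w| <= 1 -> - 1 <= t * w <= 1.
  by move=> w1; rewrite -ler_norml normrM (gtr0_norm t0) mulr_ile1// ltW.
have /andP[? ?] := te _ e1; have /andP[? ?] := te _ e2.
rewrite /u !indicE !mem_set ?mulr1.
- rewrite /aff_eval /dot /= /GRing.scale /=; ring.
- by split; rewrite /= in_itv/= /GRing.scale/=; lra.
- by split; rewrite /= in_itv/= /GRing.scale/=; lra.
Qed.

(** In the direction [g] itself the hypothesis would read |g|^2 <= M |g|. If this failed, [F] would
    be positive at [g], hence by continuity at some rational point nearby. Rational directions are
    used because their exceptional null sets can be united. *)
Lemma enorm_le_of_rational (g : plane R) (M : R) :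
  (forall p q : rat, ratr p * g.1 + ratr q * g.2 <= M * enorm ((ratr p,
    ratr q) : plane R)) ->
  enorm g <= M \/ enorm g = 0.
Proof.
move=> H.
have [eg|eg] := leP (enorm g) 0; first by right; apply/eqP; rewrite eq_le eg enorm_ge0.
left; rewrite leNgt; apply/negP => Mg.
pose F (z : plane R) := z.1 * g.1 + z.2 * g.2 + (- M) * enorm (z - 0).
have cF : cont F.
  by rewrite /F; apply: contD; [cont_poly|apply: contM;
    [exact: cont_cst|exact: cont_enormB]].
have : \forall z \near g, 0 < F z.
  apply: (cF g [set t | 0 < t]); apply: lt_nbhsr.
  by rewrite /F subr0 -sqr_enorm expr2 -mulrDl mulr_gt0// subr_gt0.
move=> /nbhs_ballP[e /= e0 He].
have rr (t : R) : exists q : rat, t < ratr q < t + e.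
  have te : t < t + e by rewrite ltrDl.
  by have [q] := rat_in_itvoo te; rewrite in_itv/=; exists q.
have [[p /andP[p1 p2]] [q /andP[q1 q2]]] := (rr g.1, rr g.2).
have : 0 < F (ratr p, ratr q).
  by apply: He; split; rewrite /ball/= ltr_norml; apply/andP; split; lra.
by rewrite /F subr0 mulNr subr_gt0 ltNge H.
Qed.

End affine.

(* Nested concentric squares, each leaving a margin in the next: half-width 3/8 r for the
   cutoff tested against the measure (it exceeds the r/4 of the ball), 7/16 r for the
   cutoff of the energy, 15/32 r for the gradient bound, r/2 for the domain of u. *)
Section energy.
Context {R : realType}.
Variables (x : plane R) (r M N : R) (P : @affine_fun R).
Variables (U G1 G2 : plane R -> R).
Implicit Types (f g : R -> R).

Let s := 7 / 16 * r.
Let a := aff_slope P.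
Let Qo := (`[x.1 - s, x.1 + s] `*` `[x.2 - s, x.2 + s])%classic : set (plane R).
Let supp1 f := forall t, t \notin `[x.1 - s, x.1 + s] -> f t = 0.
Let supp2 g := forall t, t \notin `[x.2 - s, x.2 + s] -> g t = 0.

Hypothesis r0 : 0 < r.
Hypothesis N0 : 0 <= N.
Hypothesis ME : M = enorm a + 8 * N.
Hypothesis IU : integ U.
Hypothesis UP : forall z, Qo z -> `|U z - aff_eval P z| <= N * r.
Hypotheses (mG1 : measurable_fun setT G1) (mG2 : measurable_fun setT G2).
Hypothesis GM : forall z, enorm ((G1 z, G2 z) : plane R) <= M.
Hypothesis weak1 : forall f g, smooth f -> smooth g -> supp1 f -> supp2 g ->
  pint (fun z : plane R => U z * tens (derive1 f) g z) =
    - pint (fun z : plane R => G1 z * tens f g z).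
Hypothesis weak2 : forall f g, smooth f -> smooth g -> supp1 f -> supp2 g ->
  pint (fun z : plane R => U z * tens f (derive1 g) z) =
    - pint (fun z : plane R => G2 z * tens f g z).

(** [H1] and [H2] turn out to be the weak partial derivatives of [V] against product tests. *)
Let V (z : plane R) := U z - aff_eval P z.
Let H1 (z : plane R) := G1 z - a.1.
Let H2 (z : plane R) := G2 z - a.2.

Let sd f : smooth f -> smooth (derive1 f).
Proof. by move=> /smooth_deriv[]. Qed.

Let integ_tensM (F : plane R -> R) f g (k : R) : measurable_fun setT F ->
  (forall z, Qo z -> `|F z| <= k) -> smooth f -> smooth g -> supp1 f -> supp2 g ->
  integ (fun z : plane R => F z * tens f g z).
Proof.
move=> mF Fk sf sg f0 g0; have [A A0 tA] := tens_bounded sf sg f0 g0.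
have t0 z : ~ Qo z -> tens f g z = 0 by exact: tens_out.
apply: (@integ_bounded_support _ _ (x.1 - s) (x.1 + s) (x.2 - s) (x.2 + s) (`|k| * A)).
- by apply: measurable_funM => //; apply: measurable_tens; exact: smooth_continuous.
- move=> z; rewrite normrM; have [Qz|/t0->] := pselect (Qo z); last first.
    by rewrite normr0 mulr0 mulr_ge0.
  by rewrite ler_pM// (le_trans (Fk _ Qz))// ler_norm.
- by move=> z /t0->; rewrite mulr0.
Qed.

Let mU : measurable_fun setT U. Proof. exact: integ_measurable. Qed.
Let mV : measurable_fun setT V.
Proof. by apply: measurable_funB => //; exact: measurable_affine. Qed.
Let mH1 : measurable_fun setT H1. Proof. exact: measurable_funB. Qed.
Let mH2 : measurable_fun setT H2. Proof. exact: measurable_funB. Qed.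

Let G1M z : `|G1 z| <= M. Proof. exact: le_trans (normr_fst_le (G1 z, G2 z)) (GM z). Qed.
Let G2M z : `|G2 z| <= M. Proof. exact: le_trans (normr_snd_le (G1 z, G2 z)) (GM z). Qed.
Let H1M z : `|H1 z| <= M + `|a.1|.
Proof. by apply: le_trans (ler_normB _ _) _; rewrite lerD2r. Qed.
Let H2M z : `|H2 z| <= M + `|a.2|.
Proof. by apply: le_trans (ler_normB _ _) _; rewrite lerD2r. Qed.

Let T (F : plane R -> R) f g := pint (fun z : plane R => F z * tens f g z).

Let IH1 f g : smooth f -> smooth g -> supp1 f -> supp2 g ->
  integ (fun z : plane R => H1 z * tens f g z).
Proof. by move=> *; apply: integ_tensM => // z _; exact: H1M. Qed.
Let IH2 f g : smooth f -> smooth g -> supp1 f -> supp2 g ->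
  integ (fun z : plane R => H2 z * tens f g z).
Proof. by move=> *; apply: integ_tensM => // z _; exact: H2M. Qed.
Let It f g : smooth f -> smooth g -> supp1 f -> supp2 g -> integ (tens f g).
Proof. by move=> sf sg f0 g0; exact: (integ_tens sf sg f0 g0). Qed.

Let weakV1 f g : smooth f -> smooth g -> supp1 f -> supp2 g ->
  T V (derive1 f) g = - T H1 f g.
Proof.
move=> sf sg f0 g0.
have [k Pk] := affine_bounded_rectangle P (x.1 - s) (x.1 + s) (x.2 - s) (x.2 + s).
have f0' := deriv_out_itv sf f0.
have IP : integ (fun z : plane R => aff_eval P z * tens (derive1 f) g z).
  by apply: (integ_tensM (k := k)) => //; [exact: measurable_affine|exact: sd].
have IUt : integ (fun z : plane R => U z * tens (derive1 f) g z).
  have [A A0 tA] := tens_bounded (sd sf) sg f0' g0.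
  by apply: (integM (k := A)) => //; apply: measurable_tens;
    apply: smooth_continuous => //; exact: sd.
have IG : integ (fun z : plane R => G1 z * tens f g z) by apply: (integ_tensM (k := M)).
rewrite /T /V /H1.
transitivity (pint (fun z : plane R => U z * tens (derive1 f) g z)
     - pint (fun z : plane R => aff_eval P z * tens (derive1 f) g z)).
  by rewrite -pintB//; congr pint; apply/funext => z; rewrite mulrBl.
have := @pint_affine_dtens _ P f g _ _ _ _ (1, 0) sf sg f0 g0.
rewrite /= normr1 normr0 lexx ler01 dtens10 => ->//.
rewrite weak1// /dot /= mulr1 mulr0 addr0.
transitivity (- (pint (fun z : plane R => G1 z * tens f g z) - a.1 * pint (tens f g))).
  by rewrite opprB opprK addrC.
congr (- _); rewrite -pintZ; last exact: It.
rewrite -pintB//; last exact/integZ/It.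
by congr pint; apply/funext => z; rewrite mulrBl.
Qed.

Let weakV2 f g : smooth f -> smooth g -> supp1 f -> supp2 g ->
  T V f (derive1 g) = - T H2 f g.
Proof.
move=> sf sg f0 g0.
have [k Pk] := affine_bounded_rectangle P (x.1 - s) (x.1 + s) (x.2 - s) (x.2 + s).
have g0' := deriv_out_itv sg g0.
have IP : integ (fun z : plane R => aff_eval P z * tens f (derive1 g) z).
  by apply: (integ_tensM (k := k)) => //; [exact: measurable_affine|exact: sd].
have IUt : integ (fun z : plane R => U z * tens f (derive1 g) z).
  have [A A0 tA] := tens_bounded sf (sd sg) f0 g0'.
  by apply: (integM (k := A)) => //; apply: measurable_tens;
    apply: smooth_continuous => //; exact: sd.
have IG : integ (fun z : plane R => G2 z * tens f g z) by apply: (integ_tensM (k := M)).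
rewrite /T /V /H2.
transitivity (pint (fun z : plane R => U z * tens f (derive1 g) z)
     - pint (fun z : plane R => aff_eval P z * tens f (derive1 g) z)).
  by rewrite -pintB//; congr pint; apply/funext => z; rewrite mulrBl.
have := @pint_affine_dtens _ P f g _ _ _ _ (0, 1) sf sg f0 g0.
rewrite /= normr1 normr0 lexx ler01 dtens01 => ->//.
rewrite weak2// /dot /= mulr1 mulr0 add0r.
transitivity (- (pint (fun z : plane R => G2 z * tens f g z) - a.2 * pint (tens f g))).
  by rewrite opprB opprK addrC.
congr (- _); rewrite -pintZ; last exact: It.
rewrite -pintB//; last exact/integZ/It.
by congr pint; apply/funext => z; rewrite mulrBl.
Qed.

Let pint_dtens1 f g : smooth f -> smooth g -> supp1 f -> supp2 g ->
  pint (tens (derive1 f) g) = 0.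
Proof.
move=> sf sg f0 g0.
(* The constant 1 is affine of slope 0, so its pairing with a derivative vanishes. *)
have := @pint_affine_dtens _ (AffineFun 1 (0, 0)) f g _ _ _ _ (1, 0) sf sg f0 g0.
rewrite /= normr1 normr0 lexx ler01 dtens10 /dot /= !mul0r addr0 mul0r oppr0 => /(_ isT
  isT) <-.
by congr pint; apply/funext => z; rewrite /aff_eval /dot /= !mul0r !addr0 mul1r.
Qed.

Let pint_dtens2 f g : smooth f -> smooth g -> supp1 f -> supp2 g ->
  pint (tens f (derive1 g)) = 0.
Proof.
move=> sf sg f0 g0.
have := @pint_affine_dtens _ (AffineFun 1 (0, 0)) f g _ _ _ _ (0, 1) sf sg f0 g0.
rewrite /= normr1 normr0 lexx ler01 dtens01 /dot /= !mul0r addr0 mul0r oppr0 => /(_ isT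
  isT) <-.
by congr pint; apply/funext => z; rewrite /aff_eval /dot /= !mul0r !addr0 mul1r.
Qed.

(** For psi = [tens f g] and a vector field F this is |F|^2 Laplacian psi - D^2 psi F . F, in which
    the terms F_i^2 psi_ii have cancelled. *)
Definition det_density (F1 F2 : plane R -> R) f g (z : plane R) : R :=
  F1 z ^+ 2 * tens f (derive1 (derive1 g)) z + F2 z ^+ 2 * tens (derive1 (derive1 f)) g z
  - 2 * F1 z * F2 z * tens (derive1 f) (derive1 g) z.

Let integ_sqr (F1 F2 : plane R -> R) f g (k : R) : measurable_fun setT F1 ->
  measurable_fun setT F2 ->
  (forall z, `|F1 z| <= k) -> (forall z, `|F2 z| <= k) ->
  smooth f -> smooth g -> supp1 f -> supp2 g ->
  integ (fun z : plane R => F1 z * F2 z * tens f g z).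
Proof.
move=> m1 m2 F1k F2k sf sg f0 g0.
apply: (integ_tensM (F := fun z => F1 z * F2 z) (k := k * k)) => //.
  exact: measurable_funM.
by move=> z _; rewrite normrM ler_pM.
Qed.

Lemma integ_det_density (F1 F2 : plane R -> R) f g (k : R) : measurable_fun setT F1 ->
  measurable_fun setT F2 ->
  (forall z, `|F1 z| <= k) -> (forall z, `|F2 z| <= k) ->
  smooth f -> smooth g -> supp1 f -> supp2 g ->
  integ (det_density F1 F2 f g).
Proof.
move=> m1 m2 F1k F2k sf sg f0 g0.
have f0' := deriv_out_itv sf f0; have g0' := deriv_out_itv sg g0.
have f0'' := deriv_out_itv (sd sf) f0'; have g0'' := deriv_out_itv (sd sg) g0'.
apply: integB; first apply: integD.
- by apply: (integ_sqr m1 m1 F1k F1k) => //; exact/sd/sd.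
- by apply: (integ_sqr m2 m2 F2k F2k) => //; exact/sd/sd.
rewrite (_ : (fun z => _) = fun z => 2 * (F1 z * F2 z * tens (derive1 f) (derive1 g) z)).
  by apply/integZ/(integ_sqr m1 m2 F1k F2k) => //; exact: sd.
by apply/funext => z; rewrite !mulrA.
Qed.

(** With G = H + a the terms linear in H cancel in pairs: [T H1 f g''] and [T H2 f' g'] are both
    minus the pairing of [V] with [tens f' g''], and likewise with the variables exchanged. This is
    the symmetry of mixed weak derivatives. The terms quadratic in a integrate derivatives of
    compactly supported functions. *)
Lemma pint_det_density_shift f g : smooth f -> smooth g -> supp1 f -> supp2 g ->
  pint (det_density G1 G2 f g) = pint (det_density H1 H2 f g).
Proof.
move=> sf sg f0 g0.
have f0' := deriv_out_itv sf f0; have g0' := deriv_out_itv sg g0.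
have f0'' := deriv_out_itv (sd sf) f0'; have g0'' := deriv_out_itv (sd sg) g0'.
set f' := derive1 f in f0' f0''; set g' := derive1 g in g0' g0''.
set f'' := derive1 f' in f0''; set g'' := derive1 g' in g0''.
have sf' : smooth f' by exact: sd. have sg' : smooth g' by exact: sd.
have sf'' : smooth f'' by exact: sd. have sg'' : smooth g'' by exact: sd.
pose k := Num.max (M + `|a.1|) (M + `|a.2|).
have H1k z : `|H1 z| <= k by rewrite le_max H1M.
have H2k z : `|H2 z| <= k by rewrite le_max H2M orbT.
pose D (z : plane R) := 2 * a.1 * (H1 z * tens f g'' z) - 2 * a.1 * (H2 z * tens f' g' z).
pose D' (z : plane R) := 2 * a.2 * (H2 z * tens f'' g z) - 2 * a.2 * (H1 z * tens f' g' z).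
pose K (z : plane R) := a.1 * a.1 * tens f g'' z + a.2 * a.2 * tens f'' g z.
pose K' (z : plane R) := - 2 * a.1 * a.2 * tens f' g' z.
have ID : integ D by apply: integB; apply: integZ; (exact: IH1 || exact: IH2).
have ID' : integ D' by apply: integB; apply: integZ; (exact: IH2 || exact: IH1).
have IK : integ K by apply: integD; apply: integZ; exact: It.
have IK' : integ K' by apply: integZ; exact: It.
have Idet : integ (det_density H1 H2 f g) by exact: (integ_det_density mH1 mH2 H1k H2k).
have -> : det_density G1 G2 f g =
  fun z => det_density H1 H2 f g z + (D z + D' z + (K z + K' z)).
  apply/funext => z; rewrite /det_density /D /D' /K /K' /H1 /H2 -/f' -/g' -/f'' -/g''; ring.
have IDD := integD ID ID'; have IKK := integD IK IK'.
rewrite (pintD Idet (integD IDD IKK)) (pintD IDD IKK) (pintD ID ID') (pintD IK IK').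
have -> : pint D = 0.
  have X1 := IH1 sf sg'' f0 g0''; have X2 := IH2 sf' sg' f0' g0'.
  rewrite /D (pintB (integZ _ X1) (integZ _ X2)) (pintZ _ X1) (pintZ _ X2).
  have E : T H1 f g'' = T H2 f' g'.
    exact: (oppr_inj (etrans (esym (weakV1 sf sg'' f0 g0'')) (weakV2 sf' sg' f0' g0'))).
  by rewrite -/(T H1 f g'') -/(T H2 f' g') E subrr.
have -> : pint D' = 0.
  have X1 := IH2 sf'' sg f0'' g0; have X2 := IH1 sf' sg' f0' g0'.
  rewrite /D' (pintB (integZ _ X1) (integZ _ X2)) (pintZ _ X1) (pintZ _ X2).
  have E : T H2 f'' g = T H1 f' g'.
    exact: (oppr_inj (etrans (esym (weakV2 sf'' sg f0'' g0)) (weakV1 sf' sg' f0' g0'))).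
  by rewrite -/(T H2 f'' g) -/(T H1 f' g') E subrr.
have -> : pint K = 0.
  have X1 := It sf sg'' f0 g0''; have X2 := It sf'' sg f0'' g0.
  rewrite /K (pintD (integZ _ X1) (integZ _ X2)) (pintZ _ X1) (pintZ _ X2).
  by rewrite (pint_dtens2 sf sg' f0 g0') (pint_dtens1 sf' sg f0' g0) !mulr0 addr0.
have -> : pint K' = 0.
  by rewrite /K' (pintZ _ (It sf' sg' f0' g0')) (pint_dtens1 sf sg' f0 g0') mulr0.
by rewrite !addr0.
Qed.

(** The support has area at most r^2. The term M^2 - |a|^2 gives the 64. Each of the two cross terms
    is 2 a_i times the integral of [V], of size N r, against a derivative of size B / r; together
    they are at most 4 |a| N B r^2, which gives the 4 B. *)
Lemma energy_bound f g (B : R) : smooth f -> smooth g -> supp1 f -> supp2 g ->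
  (forall t, 0 <= f t <= 1) -> (forall t, 0 <= g t <= 1) ->
  (forall t, `|derive1 f t| <= B / r) -> (forall t, `|derive1 g t| <= B / r) -> 0 <= B ->
  pint (fun z : plane R => (H1 z ^+ 2 + H2 z ^+ 2) * tens f g z) <=
    (64 + 4 * B) * (N * (enorm a + N)) * r ^+ 2.
Proof.
move=> sf sg f0 g0 f1 g1 fB gB B0.
have f0' := deriv_out_itv sf f0; have g0' := deriv_out_itv sg g0.
set f' := derive1 f in f0' fB; set g' := derive1 g in g0' gB.
have sf' : smooth f' by exact: sd. have sg' : smooth g' by exact: sd.
have an0 := enorm_ge0 a.
have M0 : 0 <= M by rewrite ME addr_ge0 ?mulr_ge0.
have X := It sf sg f0 g0; have X1 := IH1 sf sg f0 g0; have X2 := IH2 sf sg f0 g0.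
have tfg z : 0 <= tens f g z <= 1.
  by rewrite /tens; have /andP[? ?] := f1 z.1; have /andP[? ?] := g1 z.2;
    rewrite mulr_ge0// mulr_ile1.
have Qr : pint (\1_Qo) <= r ^+ 2.
  rewrite /pint /Rintegral integral_indic//; last exact: measurable_rectangle.
  rewrite setIT lebesgue2_rectangle !lebesgue_measure_itv/= !lte_fin.
  have sr : 0 < s by rewrite /s mulr_gt0// divr_gt0.
  rewrite !ifT; [|lra|lra].
  rewrite -!EFinB -EFinM/= /s expr2; nra.
have IQ : integ (\1_Qo : plane R -> R) by exact: integ_rectangle.
have bnd (F : plane R -> R) (k : R) : integ F -> 0 <= k -> (forall z, Qo z ->
  `|F z| <= k) ->
    (forall z, ~ Qo z -> F z = 0) -> `|pint F| <= k * r ^+ 2.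
  move=> IF k0 Fk F0; apply: le_trans (_ : k * pint (\1_Qo) <= _);
    last by rewrite ler_wpM2l.
  have ptw z : `|F z| <= k * \1_Qo z.
    rewrite indicE; have [|zQ] := boolP (z \in Qo); first by rewrite inE => /Fk;
      rewrite mulr1.
    by rewrite F0 ?normr0 ?mulr0//; move=> /mem_set zQ'; rewrite zQ' in zQ.
  rewrite -pintZ// ler_norml; apply/andP; split.
    rewrite -pintN; last exact: integZ.
    apply: pint_le => //; first exact/integN/integZ.
    by move=> z; have := ptw z; rewrite ler_norml => /andP[].
  apply: pint_le => //; first exact: integZ.
  by move=> z; have := ptw z; rewrite ler_norml => /andP[].
have Itfg : `|pint (tens f g)| <= 1 * r ^+ 2.
  apply: bnd => // z; last exact: tens_out.
  by move=> _; have /andP[t0 t1] := tfg z; rewrite ger0_norm.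
have BV z (F G : R -> R) : Qo z -> `|F z.1| <= 1 -> `|G z.2| <= B / r ->
  `|V z * (F z.1 * G z.2)| <= N * B.
  move=> Qz F1 GB; rewrite !normrM.
  rewrite (_ : N * B = N * r * (1 * (B / r))); last by field; rewrite gt_eqF.
  by rewrite ler_pM// ?mulr_ge0// ?UP// ler_pM.
have IV (F G : R -> R) : smooth F -> smooth G -> supp1 F -> supp2 G ->
  integ (fun z : plane R => V z * tens F G z).
  by move=> *; apply: (integ_tensM (k := N * r)).
have n01 (F : R -> R) t : 0 <= F t <= 1 -> `|F t| <= 1 by move=> /andP[? ?];
  rewrite ger0_norm.
have TV1 : `|T V f' g| <= N * B * r ^+ 2.
  apply: bnd; [exact: IV|exact: mulr_ge0| |].
    move=> z Qz; rewrite /tens [f' _ * _]mulrC (BV z (fun=> g z.2) (fun=> f' z.1))//.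
    exact: n01.
  by move=> z zQ; rewrite (tens_out f0' g0 zQ) mulr0.
have TV2 : `|T V f g'| <= N * B * r ^+ 2.
  apply: bnd; [exact: IV|exact: mulr_ge0| |].
    by move=> z Qz; rewrite /tens (BV z (fun=> f z.1) (fun=> g' z.2))// n01.
  by move=> z zQ; rewrite (tens_out f0 g0' zQ) mulr0.
pose D (z : plane R) := (M ^+ 2 - enorm a ^+ 2) * tens f g z
   - (2 * a.1 * (H1 z * tens f g z) + 2 * a.2 * (H2 z * tens f g z)).
have ID12 := integD (integZ (2 * a.1) X1) (integZ (2 * a.2) X2).
have ID : integ D by apply: integB => //; exact: integZ.
have M2 z : H1 z ^+ 2 + H2 z ^+ 2 <= M ^+ 2 - enorm a ^+ 2 - (2 * a.1 * H1 z +
  2 * a.2 * H2 z).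
  have : enorm ((G1 z, G2 z) : plane R) ^+ 2 <= M ^+ 2.
    by rewrite ler_pXn2r// nnegrE enorm_ge0.
  rewrite !sqr_enorm /= /H1 /H2 !expr2; lra.
apply: le_trans (_ : pint D <= _).
  have [k1 [k2 [Hk1 Hk2]]] : exists k1 k2, (forall z, `|H1 z| <= k1) /\ (forall z,
    `|H2 z| <= k2).
    by exists (M + `|a.1|), (M + `|a.2|).
  apply: pint_le => //.
    apply: (integ_tensM (k := k1 ^+ 2 + k2 ^+ 2)) => //.
      by apply: measurable_funD; exact: measurable_funX.
    move=> z _; rewrite ger0_norm ?addr_ge0 ?sqr_ge0//.
    by rewrite lerD// -real_normK ?num_real// ler_pXn2r ?nnegrE// (le_trans _ (Hk1 z),
      le_trans _ (Hk2 z)).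
  move=> z; rewrite /D; have /andP[t0 _] := tfg z.
  have := ler_wpM2r t0 (M2 z); lra.
rewrite /D (pintB (integZ _ X) ID12) (pintD (integZ _ X1) (integZ _ X2)) !pintZ//.
have E1 := weakV1 sf sg f0 g0; have E2 := weakV2 sf sg f0 g0.
have -> : pint (fun z : plane R => H1 z * tens f g z) = - T V f' g by rewrite E1 opprK.
have -> : pint (fun z : plane R => H2 z * tens f g z) = - T V f g' by rewrite E2 opprK.
have a1 := normr_fst_le a; have a2 := normr_snd_le a.
have MM : M ^+ 2 - enorm a ^+ 2 = 16 * N * enorm a + 64 * N ^+ 2 by rewrite ME; ring.
have r2 : 0 < r ^+ 2 by rewrite exprn_gt0.
have P1 : (M ^+ 2 - enorm a ^+ 2) * pint (tens f g) <= (16 * N * enorm a +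
  64 * N ^+ 2) * r ^+ 2.
  rewrite MM ler_wpM2l ?addr_ge0 ?mulr_ge0 ?sqr_ge0//.
  by rewrite mul1r in Itfg; apply: le_trans Itfg; exact: ler_norm.
have P2 (c t : R) : `|c| <= enorm a -> `|t| <= N * B * r ^+ 2 ->
  2 * c * t <= 2 * (enorm a * (N * B * r ^+ 2)).
  move=> cc tt; rewrite -mulrA ler_pM2l//; apply: le_trans (ler_norm _) _.
  by rewrite normrM ler_pM.
have Q1 := P2 _ _ a1 TV1; have Q2 := P2 _ _ a2 TV2.
have z1 : 0 <= N * enorm a * r ^+ 2 by rewrite !mulr_ge0// ltW.
have z2 : 0 <= N * N * B * r ^+ 2 by rewrite !mulr_ge0// ltW.
lra.
Qed.

(** Once a is subtracted, second derivatives of size A / r^2 and products of first derivatives of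
    size A^2 / r^2 bound the integrand by (A + A^2) / r^2 times |H|^2 on the smaller square, where
    the energy cutoff is at least delta^2. The r^-2 cancels the r^2 of the energy. *)
Lemma pint_det_density_le f g h k (A B delta : R) :
  smooth f -> smooth g -> smooth h -> smooth k ->
  (forall t, t \notin `[x.1 - 3 / 8 * r, x.1 + 3 / 8 * r] -> f t = 0) ->
  (forall t, t \notin `[x.2 - 3 / 8 * r, x.2 + 3 / 8 * r] -> g t = 0) ->
  supp1 h -> supp2 k ->
  (forall t, `|f t| <= 1) -> (forall t, `|g t| <= 1) ->
  (forall t, `|derive1 f t| <= A / r) -> (forall t, `|derive1 g t| <= A / r) ->
  (forall t, `|derive1 (derive1 f) t| <= A / r ^+ 2) ->
  (forall t, `|derive1 (derive1 g) t| <= A / r ^+ 2) ->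
  (forall t, 0 <= h t <= 1) -> (forall t, 0 <= k t <= 1) ->
  (forall t, `|derive1 h t| <= B / r) -> (forall t, `|derive1 k t| <= B / r) ->
  (forall t, t \in `[x.1 - 3 / 8 * r, x.1 + 3 / 8 * r] -> delta <= h t) ->
  (forall t, t \in `[x.2 - 3 / 8 * r, x.2 + 3 / 8 * r] -> delta <= k t) ->
  0 <= A -> 0 <= B -> 0 < delta ->
  pint (det_density G1 G2 f g) <=
    (A + A ^+ 2) / delta ^+ 2 * ((64 + 4 * B) * (N * (enorm a + N))).
Proof.
move=> sf sg sh sk f0 g0 h0 k0 f1 g1 fA gA fA2 gA2 h1 k1 hB kB hd kd A0 B0 d0.
have sub (w : R) t : t \notin `[w - s, w + s] -> t \notin `[w - 3 / 8 * r, w + 3 / 8 * r].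
  apply: contra; rewrite !in_itv/= /s => /andP[? ?]; move: r0 => ?; apply/andP; split; lra.
have F0 : supp1 f by move=> t /sub/f0.
have G0 : supp2 g by move=> t /sub/g0.
have f0' := deriv_out_itv sf f0; have g0' := deriv_out_itv sg g0.
have f0'' := deriv_out_itv (sd sf) f0'; have g0'' := deriv_out_itv (sd sg) g0'.
rewrite (pint_det_density_shift sf sg F0 G0).
have E := energy_bound sh sk h0 k0 h1 k1 hB kB B0.
have r2 : 0 < r ^+ 2 by rewrite exprn_gt0.
pose K := (A + A ^+ 2) / r ^+ 2.
have K0 : 0 <= K by rewrite /K divr_ge0 ?addr_ge0 ?sqr_ge0// ltW.
have d20 : 0 < delta ^+ 2 by rewrite exprn_gt0.
pose kk := Num.max (M + `|a.1|) (M + `|a.2|).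
have H1k z : `|H1 z| <= kk by rewrite le_max H1M.
have H2k z : `|H2 z| <= kk by rewrite le_max H2M orbT.
have kk0 : 0 <= kk by exact: le_trans (H1k 0).
have Ien : integ (fun z : plane R => (H1 z ^+ 2 + H2 z ^+ 2) * tens h k z).
  apply: (integ_tensM (k := kk ^+ 2 + kk ^+ 2)) => //.
    by apply: measurable_funD; exact: measurable_funX.
  move=> z _; rewrite ger0_norm ?addr_ge0 ?sqr_ge0//.
  rewrite lerD// -real_normK ?num_real// ler_pXn2r ?nnegrE//.
apply: le_trans (_ : K / delta ^+ 2 * pint (fun z : plane R => (H1 z ^+ 2 +
  H2 z ^+ 2) * tens h k z) <= _); last first.
  apply: le_trans (_ : K / delta ^+ 2 * ((64 + 4 * B) * (N * (enorm a + N)) * r ^+ 2) <= _).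
    by rewrite ler_wpM2l// divr_ge0// ltW.
  rewrite le_eqVlt; apply/orP; left; apply/eqP; rewrite /K; field.
  by rewrite !gt_eqF.
rewrite -pintZ//; apply: pint_le => [||z].
- exact: (integ_det_density mH1 mH2 H1k H2k).
- exact: integZ.
have hk0 : 0 <= tens h k z.
  by rewrite /tens; have /andP[? ?] := h1 z.1; have /andP[? ?] := k1 z.2; rewrite mulr_ge0.
have [zS|zS] := pselect ((`[x.1 - 3 / 8 * r, x.1 + 3 / 8 * r] `*` `[x.2 - 3 / 8 * r,
  x.2 + 3 / 8 * r])%classic z); last first.
  rewrite /det_density (tens_out f0 g0'' zS) (tens_out f0'' g0 zS) (tens_out f0' g0' zS).
  rewrite !mulr0 addr0 subr0; apply: mulr_ge0; first by rewrite divr_ge0// ltW.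
  by rewrite mulr_ge0 ?addr_ge0 ?sqr_ge0.
have dhk : delta ^+ 2 <= tens h k z.
  by case: zS => z1 z2; rewrite expr2 /tens ler_pM ?(ltW d0)// ?hd ?kd.
have tA (F G : R -> R) (p q : R) : (forall t, `|F t| <= p) -> (forall t, `|G t| <= q) ->
  `|tens F G z| <= p * q.
  by move=> Fp Gq; rewrite /tens normrM ler_pM.
have T1 := tA _ _ _ _ f1 gA2; have T2 := tA _ _ _ _ fA2 g1; have T3 := tA _ _ _ _ fA gA.
apply: le_trans (_ : K * (H1 z ^+ 2 + H2 z ^+ 2) <= _); last first.
  have -> : K / delta ^+ 2 * ((H1 z ^+ 2 + H2 z ^+ 2) * tens h k z) =
      K * ((H1 z ^+ 2 + H2 z ^+ 2) * (tens h k z / delta ^+ 2)).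
    by field; rewrite gt_eqF.
  rewrite ler_wpM2l// ler_peMr ?addr_ge0 ?sqr_ge0//.
  by rewrite ler_pdivlMr// mul1r.
rewrite /det_density.
have S1 : H1 z ^+ 2 * tens f (derive1 (derive1 g)) z <= H1 z ^+ 2 * (A / r ^+ 2).
  by rewrite ler_wpM2l ?sqr_ge0// (le_trans (ler_norm _))// (le_trans T1)// mul1r.
have S2 : H2 z ^+ 2 * tens (derive1 (derive1 f)) g z <= H2 z ^+ 2 * (A / r ^+ 2).
  by rewrite ler_wpM2l ?sqr_ge0// (le_trans (ler_norm _))// (le_trans T2)// mulr1.
have S3 : - (2 * H1 z * H2 z * tens (derive1 f) (derive1 g) z) <= (H1 z ^+ 2 +
  H2 z ^+ 2) * (A ^+ 2 / r ^+ 2).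
  apply: le_trans (ler_norm _) _; rewrite normrN normrM ler_pM//; last first.
    apply: le_trans T3 _; rewrite le_eqVlt; apply/orP; left; apply/eqP; field.
    by rewrite gt_eqF.
  rewrite !normrM (gtr0_norm (ltr0n _ 2)) -(real_normK (num_real (H1 z))) -(real_normK
    (num_real (H2 z))).
  have := sqr_ge0 (`|H1 z| - `|H2 z|); rewrite sqrrB; lra.
rewrite /K mulrDl; lra.
Qed.

End energy.

(** * The gradient bound *)

Section gradient_bound.
Context {R : realType}.
Variables (x : plane R) (r M : R) (U G1 G2 : plane R -> R).
Implicit Types (f g : R -> R).

Let s := 15 / 32 * r.
Let supp1 f := forall t, t \notin `[x.1 - s, x.1 + s] -> f t = 0.
Let supp2 g := forall t, t \notin `[x.2 - s, x.2 + s] -> g t = 0.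

Hypothesis r0 : 0 < r.
Hypothesis M0 : 0 <= M.
Hypotheses (IU : integ U) (IG1 : integ G1) (IG2 : integ G2).
Hypothesis slope : forall y z : plane R, `|y.1 - x.1| <= r / 2 -> `|y.2 - x.2| <= r / 2 ->
  `|z.1 - x.1| <= r / 2 -> `|z.2 - x.2| <= r / 2 -> enorm (z - y) <= r / 4 ->
  U z - U y <= M * enorm (z - y).
Hypothesis weak1 : forall f g, smooth f -> smooth g -> supp1 f -> supp2 g ->
  pint (fun z : plane R => U z * tens (derive1 f) g z) =
    - pint (fun z : plane R => G1 z * tens f g z).
Hypothesis weak2 : forall f g, smooth f -> smooth g -> supp1 f -> supp2 g ->
  pint (fun z : plane R => U z * tens f (derive1 g) z) =
    - pint (fun z : plane R => G2 z * tens f g z).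

Lemma enormZ (t : R) (e : plane R) : 0 <= t -> enorm (t *: e) = t * enorm e.
Proof.
move=> t0; rewrite /enorm /dot /= /GRing.scale /=.
rewrite (_ : _ + _ = t ^+ 2 * (e.1 * e.1 + e.2 * e.2)); last by ring.
by rewrite sqrtrM ?sqr_ge0// sqrtr_sqr ger0_norm.
Qed.

Let directional f g (e : plane R) : smooth f -> smooth g -> supp1 f -> supp2 g ->
  (forall z, 0 <= tens f g z) ->
  pint (fun z : plane R => (e.1 * G1 z +
    e.2 * G2 z) * tens f g z) <= M * enorm e * pint (tens f g).
Proof.
move=> sf sg f0 g0 fg0.
have f0' := deriv_out_itv sf f0; have g0' := deriv_out_itv sg g0.
have [_ sf'] := smooth_deriv sf; have [_ sg'] := smooth_deriv sg.
have mt f' g' : smooth f' -> smooth g' -> measurable_fun setT (tens f' g').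
  by move=> ? ?; apply: measurable_tens; exact: smooth_continuous.
have It (F : plane R -> R) f' g' : integ F -> smooth f' -> smooth g' -> supp1 f' ->
  supp2 g' ->
    integ (fun z : plane R => F z * tens f' g' z).
  move=> IF sf1 sg1 f1 g1; have [A A0 tA] := tens_bounded sf1 sg1 f1 g1.
  by apply: (integM (k := A)) => //; exact: mt.
have e0 := enorm_ge0 e.
(* Steps below [t0] move points by at most r/32, the margin between the squares of half-width 15/32
   r and r/2; the 1 in the denominator covers [e = 0]. *)
pose t0 := r / (32 * (enorm e + 1)).
have t00 : 0 < t0 by rewrite divr_gt0// mulr_gt0// ltr_wpDl.
have -> : pint (fun z : plane R => (e.1 * G1 z + e.2 * G2 z) * tens f g z) =
    - pint (fun z : plane R => U z * dtens f g e z).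
  have J1 := It _ _ _ IG1 sf sg f0 g0; have J2 := It _ _ _ IG2 sf sg f0 g0.
  have K1 := It _ _ _ IU sf' sg f0' g0; have K2 := It _ _ _ IU sf sg' f0 g0'.
  transitivity (e.1 * pint (fun z : plane R => G1 z * tens f g z) +
    e.2 * pint (fun z : plane R => G2 z * tens f g z)).
    rewrite -(pintZ _ J1) -(pintZ _ J2) -(pintD (integZ _ J1) (integZ _ J2)).
    by congr pint; apply/funext => z; ring.
  transitivity (- (e.1 * pint (fun z : plane R => U z * tens (derive1 f) g z) +
    e.2 * pint (fun z : plane R => U z * tens f (derive1 g) z))).
    by rewrite weak1// weak2//; ring.
  rewrite -(pintZ _ K1) -(pintZ _ K2) -(pintD (integZ _ K1) (integZ _ K2)).
  by congr (- pint _); apply/funext => z; rewrite /dtens; ring.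
apply: (diff_quotient_le (t0 := t0) IU sf sg f0 g0) => // z t tz /andP[tp tt0].
have z1 : z.1 \in `[x.1 - s, x.1 + s].
  by apply/negP => /negP/f0 f0z; move: tz; rewrite /tens f0z mul0r eqxx.
have z2 : z.2 \in `[x.2 - s, x.2 + s].
  by apply/negP => /negP/g0 g0z; move: tz; rewrite /tens g0z mulr0 eqxx.
have te : t * enorm e <= r / 32.
  apply: le_trans (_ : t0 * (enorm e + 1) <= _).
    by rewrite ler_pM// ?(ltW tp)// ?(ltW tt0)// lerDl.
  by rewrite le_eqVlt; apply/orP; left; apply/eqP; rewrite /t0; field; lra.
have tE : enorm (z - (z - t *: e)) = t * enorm e by rewrite subKr enormZ// ltW.
have te1 : `|t * e.1| <= r / 32.
  by apply: le_trans te; rewrite normrM (gtr0_norm tp) ler_wpM2l ?normr_fst_le// ltW.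
have te2 : `|t * e.2| <= r / 32.
  by apply: le_trans te; rewrite normrM (gtr0_norm tp) ler_wpM2l ?normr_snd_le// ltW.
move: z1 z2 te1 te2; rewrite !in_itv/= !ler_norml /s => /andP[? ?] /andP[? ?] /andP[? ?]
  /andP[? ?].
have rr := r0.
have := slope (y := z - t *: e) (z := z); rewrite tE mulrAC -mulrA; apply.
all: rewrite ?ler_norml /= /GRing.scale /=; try (apply/andP; split); lra.
Qed.

(** Cut off by the indicator, the inequality in the direction [e] becomes the nonnegativity of an
    integrable function on the whole plane, as [ae_ge0_of_rectangles] requires. *)
Let fe (e z : plane R) : R :=
  \1_(`]x.1 - s, x.1 + s[ `*` `]x.2 - s, x.2 + s[)%classic z *
  (M * enorm e - (e.1 * G1 z + e.2 * G2 z)).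

(** Bumps on rational rectangles clipped to the square are admissible in [directional] and tend to
    indicators, so [fe e] has a nonnegative integral over each rational rectangle. Uniting the null
    sets of all rational [e] bounds every rational direction at almost every point of the square. *)
Lemma gradient_le_ae : \forall z \ae lebesgue2,
  (`]x.1 - s, x.1 + s[ `*` `]x.2 - s, x.2 + s[)%classic z ->
  enorm ((G1 z, G2 z) : plane R) <= M.
Proof.
set Qo := (`]x.1 - s, x.1 + s[ `*` `]x.2 - s, x.2 + s[)%classic : set (plane R).
have mQo : measurable Qo by exact: measurable_rectangle.
have i1 (D : set (plane R)) z : `|\1_D z| <= 1 :> R.
  by rewrite indicE; case: (_ \in _); rewrite ?normr1// normr0.
have IQo : integ (\1_Qo : plane R -> R).
  apply: (integ_le _ (integ_rectangle (x.1 - s) (x.1 + s) (x.2 - s) (x.2 + s))).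
    exact: measurable_indic.
  move=> z; rewrite !indicE; have [|_] := boolP (z \in Qo); last by rewrite normr0.
  rewrite inE => -[/= z1 z2]; rewrite normr1 mem_set//; split; exact: subset_itv_oo_cc.
have IeG (e : plane R) : integ (fun z => e.1 * G1 z + e.2 * G2 z).
  by apply: integD; exact: integZ.
have Ife e : integ (fe e).
  rewrite (_ : fe e = fun z => M * enorm e * \1_Qo z - (e.1 * G1 z +
    e.2 * G2 z) * \1_Qo z); last first.
    by apply/funext => z; rewrite /fe mulrBr; congr (_ - _); rewrite mulrC.
  apply: integB; first exact: integZ.
  by apply: (integM (k := 1)) => //; exact: measurable_indic.
have aefe e : \forall z \ae lebesgue2, 0 <= fe e z.
  apply: ae_ge0_of_rectangles => // a b c d _ _.
  (* Clipping may leave an empty interval; the bump is then identically 0, and so is its limit. *)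
  pose a' : R := Num.max (ratr a) (x.1 - s); pose b' : R := Num.min (ratr b) (x.1 + s).
  pose c' : R := Num.max (ratr c) (x.2 - s); pose d' : R := Num.min (ratr d) (x.2 + s).
  pose f n := bump a' b' n.+1%:R; pose g n := bump c' d' n.+1%:R.
  have sf n : smooth (f n) by exact: smooth_bump.
  have sg n : smooth (g n) by exact: smooth_bump.
  have f0 n : supp1 (f n).
    move=> t; rewrite /f => tn; apply: bump_out => //; apply: contra tn.
    rewrite !in_itv/= /a' /b' gt_max lt_min => /andP[/andP[_ t1] /andP[_ t2]].
    by rewrite !ltW.
  have g0 n : supp2 (g n).
    move=> t; rewrite /g => tn; apply: bump_out => //; apply: contra tn.
    rewrite !in_itv/= /c' /d' gt_max lt_min => /andP[/andP[_ t1] /andP[_ t2]].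
    by rewrite !ltW.
  have mt n : measurable_fun setT (tens (f n) (g n)).
    by apply: measurable_tens; exact: smooth_continuous.
  have t01 n z : 0 <= tens (f n) (g n) z <= 1.
    by rewrite /tens mulr_ge0 ?bump_ge0// mulr_ile1 ?bump_ge0 ?bump_le1.
  have nt1 n z : `|tens (f n) (g n) z| <= 1.
    by have /andP[t0 t1] := t01 n z; rewrite ger0_norm.
  have fgQ n z : ~ Qo z -> tens (f n) (g n) z = 0.
    move=> zQ; rewrite /tens.
    have [z1|z1] := boolP (z.1 \in `]x.1 - s, x.1 + s[); last first.
      rewrite /f bump_out ?mul0r//; apply: contra z1.
      rewrite !in_itv/= /a' /b' gt_max lt_min => /andP[/andP[_ t1] /andP[_ t2]].
      by rewrite t1.
    rewrite [g n _]bump_out ?mulr0//; apply/negP.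
    rewrite !in_itv/= /c' /d' gt_max lt_min => /andP[/andP[_ t1] /andP[_ t2]].
    by apply: zQ; split => //=; rewrite in_itv/= t1.
  have IF n : integ (fun z : plane R => fe e z * tens (f n) (g n) z).
    by apply: (integM (k := 1)).
  have cvgI : pint (fun z : plane R => fe e z * tens (f n) (g n) z) @[n --> \oo] -->
     pint (fun z : plane R => fe e z * (\1_(`]a', b'[%classic) z.1 * \1_(`]c',
       d'[%classic) z.2)).
    apply: (@pint_dominated _ _ _ (fun z => `|fe e z|)).
    - by move=> n; exact: integ_measurable.
    - apply: measurable_funM; first exact: integ_measurable.
      have m1 (i : interval R) : measurable_fun setT (\1_[set` i] : measurableTypeR R -> R).
        exact: measurable_indic.
      apply: measurable_funM.
        by apply: (measurableT_comp (m1 _)); exact: measurable_fst.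
      by apply: (measurableT_comp (m1 _)); exact: measurable_snd.
    - by move=> z; apply: cvgMr; apply: cvgM; exact: bump_cvg.
    - exact: integ_norm.
    - by move=> n z; rewrite normrM ler_piMr.
  have -> : (fun z : plane R => \1_(`]ratr a, ratr b[%classic) z.1 *
        (\1_(`]ratr c, ratr d[%classic) z.2 * fe e z)) =
      fun z => fe e z * (\1_(`]a', b'[%classic) z.1 * \1_(`]c', d'[%classic) z.2).
    apply/funext => z; rewrite mulrA mulrC; rewrite /fe indicE.
    have [|_] := boolP (z \in _); last by rewrite !mul0r.
    rewrite inE => -[/=]; rewrite !in_itv/= => /andP[u1 u2] /andP[u3 u4].
    by rewrite !indicE !mem_setE !in_itv/= /a' /b' /c' /d' !gt_max !lt_min u1 u2 u3 u4
      !andbT.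
  refine (cvgr_to_ge cvgI _); apply: nearW => n.
  have It := integ_tens (sf n) (sg n) (f0 n) (g0 n).
  have -> : (fun z : plane R => fe e z * tens (f n) (g n) z) =
      fun z => M * enorm e * tens (f n) (g n) z - (e.1 * G1 z +
        e.2 * G2 z) * tens (f n) (g n) z.
    apply/funext => z; have [zQ|/fgQ->] := pselect (Qo z); last by rewrite !mulr0 subr0.
    by rewrite /fe indicE mem_set// mul1r mulrBl.
  rewrite pintB; [|exact: integZ|by apply: (integM (k := 1))].
  rewrite pintZ// subr_ge0; apply: directional => // z.
  by have /andP[] := t01 n z.
have : \forall z \ae lebesgue2, forall pq : rat * rat, 0 <= fe (ratr pq.1, ratr pq.2) z.
  by apply: ae_forall_countable => pq; exact: aefe.
apply: ae_impl => z H zQ.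
have := @enorm_le_of_rational _ (G1 z, G2 z) M; case=> [p q|//|->//].
have := H (p, q); rewrite /fe indicE mem_set// mul1r subr_ge0.
exact.
Qed.

End gradient_bound.

(** * Assembling the proof *)

Section bridge.
Context {R : realType}.
Implicit Types (Omega Q : set (plane R)).

(** A strict violation at one point persists by continuity on an open box, which has positive
    measure. Comparison with cones uses values on circles, which an essential supremum alone does
    not control. *)
Lemma ae_continuous_le (O : set (plane R)) (F : plane R -> R) (k : R) :
  open O -> (forall z, O z -> {for z, continuous F}) ->
  (\forall z \ae lebesgue2, O z -> F z <= k) -> forall z, O z -> F z <= k.
Proof.
move=> oO cF [N [mN N0 HN]] z Oz; rewrite leNgt; apply/negP => kF.
have : \forall w \near z, O w /\ k < F w.
  apply: filterI; first exact: open_nbhs_nbhs.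
  by have := cF z Oz => /(_ [set t | k < t]); apply; exact: lt_nbhsr.
move=> /nbhs_ballP[e /= e0 He].
pose S := (`]z.1 - e, z.1 + e[ `*` `]z.2 - e, z.2 + e[)%classic : set (plane R).
have SN : S `<=` N.
  move=> w [/=]; rewrite !in_itv/= => /andP[? ?] /andP[? ?].
  have [Ow kw] : O w /\ k < F w.
    by apply: He; split; rewrite /ball/= ltr_norml; apply/andP; split; lra.
  by apply: HN => /(_ Ow); rewrite leNgt kw.
have : (lebesgue2 S <= lebesgue2 N)%E.
  by apply: le_measure; rewrite ?inE//; exact: measurable_rectangle.
rewrite N0 leNgt => /negP; apply.
rewrite lebesgue2_rectangle !lebesgue_measure_itv/= !lte_fin.
rewrite !ifT; [|lra|lra].
by rewrite -!EFinB -EFinM lte_fin mulr_gt0//; lra.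
Qed.

(** The L^oo norm is the essential supremum only if the whole space has positive measure. *)
Lemma lebesgue2_setT_gt0 : (0 < lebesgue2 [set: plane R])%E.
Proof.
apply: (@lt_le_trans _ _ (lebesgue2 (`]0, 1[ `*` `]0, 1[ : set (plane R)))).
  rewrite lebesgue2_rectangle !lebesgue_measure_itv/= lte_fin ltr01.
  by rewrite -!EFinB -EFinM lte_fin subr0 mulr1.
by apply: le_measure; rewrite ?inE//; exact: measurable_rectangle.
Qed.

Lemma open_eball (x : plane R) (r : R) : open (eball x r).
Proof.
rewrite openE => y yr.
by apply: (@cont_enormB R x y [set t | t < r]); exact: lt_nbhsl.
Qed.

Lemma Linfty_norm_le (x : plane R) (r n : R) (F : plane R -> R) :
  (forall z, eball x r z -> {for z, continuous F}) ->
  (Linfty_norm (eball x r) F <= n%:E)%E ->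
  forall z, eball x r z -> `|F z| <= n.
Proof.
move=> cF; rewrite /Linfty_norm unlock lebesgue2_setT_gt0 => /ess_supP aeF.
apply: (@ae_continuous_le (eball x r) (fun z => `|F z|)); first exact: open_eball.
  move=> z zr; apply: (@continuous_comp _ _ _ F (fun t : R => `|t|)); first exact: cF.
  exact: (@norm_continuous _ R^o).
by apply: ae_impl aeF => z /= + zr; rewrite /patch mem_set// lee_fin.
Qed.

Lemma integral_supported d (T : measurableType d) (mu : {measure set T -> \bar R})
    (Omega Q : set T) (F : T -> \bar R) : Q `<=` Omega ->
  (forall z, ~ Q z -> F z = 0%E) ->
  (\int[mu]_(z in Omega) F z = \int[mu]_z F z)%E.
Proof.
move=> QO F0; rewrite integral_mkcond; apply: eq_integral => z _.
rewrite /patch; have [//|zO] := boolP (z \in Omega).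
by rewrite F0// => /QO/mem_set zO'; rewrite zO' in zO.
Qed.

Lemma measurable_fun_patch Omega Q (F : plane R -> R) : measurable Omega -> measurable Q ->
  Q `<=` Omega -> measurable_fun Omega F -> measurable_fun setT (F \_ Q).
Proof.
move=> mO mQ QO mF; apply/(measurable_restrictT _ mQ).
exact: measurable_funS mF.
Qed.

(** On the rectangle |F| <= 1 + F^2, and both terms are integrable there. *)
Lemma L2loc_integ Omega (F : plane R -> R) (a b c d : R) : measurable Omega ->
  L2loc Omega F -> `[a, b] `*` `[c, d] `<=` Omega ->
  integ (F \_ (`[a, b] `*` `[c, d])).
Proof.
set Q := (_ `*` _)%classic => mO [mF F2] QO.
have mQ : measurable (Q : set (plane R)) by exact: measurable_rectangle.
have mFQ := measurable_fun_patch mO mQ QO mF.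
have := F2 Q (@compact_rectangle R a b c d) QO; rewrite /finite_norm => N2.
have I2 : integ (fun z => (F \_ Q) z ^+ 2).
  apply/integrableP; split; first by apply/measurable_EFinP; exact: measurable_funX.
  have := poweR_lty 2 N2; rewrite poweR_Lnorm//.
  congr (_ < _)%E; apply: eq_integral => z _ /=.
  by rewrite powR_mulrn// normrX.
apply: (integ_le mFQ (integD (integ_rectangle a b c d) I2)) => z.
rewrite /patch indicE -/Q; case: ifPn => _; last by rewrite normr0 add0r sqr_ge0.
have := sqr_ge0 (`|F z| - 1); rewrite sqrrB real_normK ?num_real//.
have := normr_ge0 (F z); have := sqr_ge0 (F z).
rewrite /=; lra.
Qed.

End bridge.

(** * Cutoffs scaled to the ball *)

Section scaled_bump.
Context {R : realType}.

Definition scaled_bump (w c r t : R) : R := bump (- w) w 1 (r^-1 * t + - (r^-1 * c)).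

Lemma derive1_affine (f : R -> R) (k b : R) : smooth f ->
  derive1 (fun t => f (k * t + b)) = fun t => k * derive1 f (k * t + b).
Proof.
move=> sf; apply/funext => t.
apply: (@has_deriv_unique _ (fun t => f (k * t + b)) t).
  exact: (smooth_deriv (smooth_affine k b sf)).1.
rewrite mulrC; apply: (has_deriv_comp ((smooth_deriv sf).1 _)).
derive_by_ring.
Qed.

Lemma derive1_scale (f : R -> R) (k : R) : smooth f ->
  derive1 (fun t => k * f t) = fun t => k * derive1 f t.
Proof.
move=> sf; apply/funext => t.
have H := has_derivM (has_deriv_cst k t) ((smooth_deriv sf).1 t).
rewrite mulr0 addr0 in H.
by rewrite derive1E; have [_] := H.
Qed.

Lemma smooth_scaled_bump w c r : smooth (scaled_bump w c r).
Proof. by apply: (smooth_affine _ _ (@smooth_bump _ _ _ _)). Qed.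

Lemma scaled_bump01 w c r t : 0 <= scaled_bump w c r t <= 1.
Proof. by rewrite bump_ge0 bump_le1. Qed.

Lemma scaled_bump_out w c r t : 0 < r -> t \notin `[c - w * r, c + w * r] ->
  scaled_bump w c r t = 0.
Proof.
move=> r0 tc; apply: bump_out => //; apply: contra tc.
rewrite -mulrBr mulrC !in_itv/= ltr_pdivlMr// ltr_pdivrMr// => /andP[? ?].
by apply/andP; split; lra.
Qed.

Lemma scaled_bump_ge w v c r t : 0 < r -> t \in `[c - v * r, c + v * r] ->
  expinv (w - v) * expinv (w - v) <= scaled_bump w c r t.
Proof.
move=> r0; rewrite in_itv/= => /andP[t1 t2]; apply: bump_ge.
rewrite -mulrBr normrM normfV (gtr0_norm r0) mulrC ler_pdivrMr// ler_norml.
by apply/andP; split; lra.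
Qed.

(** All these cutoffs are rescalings of one profile, so the chain rule gives r^-1 and r^-2 with a
    constant depending on [w] alone; this is what makes the final constant universal. *)
Lemma scaled_bump_bounds (w : R) : exists2 A : R, 0 <= A & forall c r t, 0 < r ->
  `|derive1 (scaled_bump w c r) t| <= A / r /\
  `|derive1 (derive1 (scaled_bump w c r)) t| <= A / r ^+ 2.
Proof.
pose b := bump (- w) w 1.
have sb : smooth b by exact: smooth_bump.
have b0 t : t \notin `[- w, w] -> b t = 0.
  by move=> tw; apply: bump_out => //; apply: contra tw => /subset_itv_oo_cc.
have [_ sb'] := smooth_deriv sb; have [_ sb''] := smooth_deriv sb'.
have b0' := deriv_out_itv sb b0; have b0'' := deriv_out_itv sb' b0'.
have [A1 A10 HA1] := bounded_of_compact_support (smooth_continuous sb') b0'.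
have [A2 A20 HA2] := bounded_of_compact_support (smooth_continuous sb'') b0''.
exists (A1 + A2); first exact: addr_ge0.
move=> c r t r0; have ri : 0 < r^-1 by rewrite invr_gt0.
rewrite /scaled_bump -/b (derive1_affine _ _ sb).
rewrite (derive1_scale _ (smooth_affine _ _ sb')) (derive1_affine _ _ sb'); split.
  rewrite normrM (gtr0_norm ri) mulrC ler_pM2r//.
  by apply: le_trans (HA1 _) _; rewrite lerDl.
rewrite mulrA normrM gtr0_norm ?mulr_gt0// mulrC -invfM -expr2 ler_pM2r ?invr_gt0
  ?exprn_gt0//.
by apply: le_trans (HA2 _) _; rewrite lerDr.
Qed.

End scaled_bump.

Section assembly.
Context {R : realType}.

Lemma pint_ae_eq (f h : plane R -> R) : measurable_fun setT f -> measurable_fun setT h ->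
  (\forall z \ae lebesgue2, f z = h z) -> pint f = pint h.
Proof.
move=> mf mh fh; rewrite /pint /Rintegral; congr fine.
apply: ae_eq_integral => //; [exact/measurable_EFinP|exact/measurable_EFinP|].
by apply: ae_impl fh => z -> .
Qed.

Lemma square_sub_eball (x : plane R) (r w : R) : 0 < r -> w <= r / 2 ->
  `[x.1 - w, x.1 + w] `*` `[x.2 - w, x.2 + w] `<=` eball x r.
Proof.
move=> r0 wr z [/=]; rewrite !in_itv/= => /andP[z1 z2] /andP[z3 z4].
apply: enorm_lt_of_sqr => //=.
have sq (t : R) : - (r / 2) <= t <= r / 2 -> t * t <= r / 2 * (r / 2).
  rewrite -ler_norml => tr; rewrite -!expr2 -real_normK ?num_real//.
  by rewrite ler_pXn2r// nnegrE; lra.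
have q1 := sq (z.1 - x.1) (ltac:(apply/andP; split; lra)).
have q2 := sq (z.2 - x.2) (ltac:(apply/andP; split; lra)).
have : 0 < r * r by rewrite mulr_gt0.
rewrite expr2; lra.
Qed.

Lemma neg_det_hessian_tens (f g : R -> R) (p z : plane R) : smooth f -> smooth g ->
  enorm p ^+ 2 * laplacian (tens f g) z - hessian_form (tens f g) z p =
  det_density (fun=> p.1) (fun=> p.2) f g z.
Proof.
move=> sf sg; have [_ sf'] := smooth_deriv sf; have [_ sg'] := smooth_deriv sg.
rewrite /laplacian /hessian_form /det_density !d1_tens// !d2_tens// !d1_tens//.
rewrite sqr_enorm; ring.
Qed.

End assembly.

(** * The pairing for an infinity-harmonic function on one ball *)

Section gradient_of_inf_harmonic.
Context {R : realType}.
Variables (Omega : set (plane R)) (u : plane R -> R) (g : plane R -> plane R).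
Variables (x : plane R) (r n : R) (P : @affine_fun R).

Let M := enorm (aff_slope P) + 8 * n.
Let Q := (`[x.1 - r / 2, x.1 + r / 2] `*` `[x.2 - r / 2,
  x.2 + r / 2])%classic : set (plane R).
(** Extension by 0 outside [Q] gives functions integrable on the whole plane; tests supported in [Q]
    do not see the change. *)
Let U := u \_ Q.
Let G1 := (fun z => (g z).1) \_ Q.
Let G2 := (fun z => (g z).2) \_ Q.

Hypothesis oO : open Omega.
Hypothesis uO : inf_harmonic Omega u.
Hypothesis ug : W12loc_grad Omega u g.
Hypothesis r0 : 0 < r.
Hypothesis n0 : 0 <= n.
Hypothesis BO : compactly_contained (eball x r) Omega.
Hypothesis uP : forall y, enorm (y - x) < r -> `|u y - aff_eval P y| <= n * r.

Let QB : Q `<=` eball x r. Proof. exact: square_sub_eball. Qed.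
Let QO : Q `<=` Omega.
Proof. by move=> z /QB Bz; apply: BO.2; apply: subset_closure. Qed.
Let mO : measurable Omega. Proof. exact: open_measurable_plane. Qed.
Let mQ : measurable Q. Proof. exact: measurable_rectangle. Qed.

Let IU : integ U. Proof. by case: ug => uL _ _ _; exact: (L2loc_integ mO uL QO). Qed.
Let IG1 : integ G1.
Proof. by case: ug => _ gL _ _; exact: (L2loc_integ (F := fun z => (g z).1) mO gL QO). Qed.
Let IG2 : integ G2.
Proof. by case: ug => _ _ gL _; exact: (L2loc_integ (F := fun z => (g z).2) mO gL QO). Qed.

Let UE z : Q z -> U z = u z. Proof. by move=> Qz; rewrite /U /patch mem_set. Qed.

Let M0 : 0 <= M. Proof. by rewrite addr_ge0 ?enorm_ge0 ?mulr_ge0. Qed.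

Let slope (y z : plane R) : `|y.1 - x.1| <= r / 2 -> `|y.2 - x.2| <= r / 2 ->
  `|z.1 - x.1| <= r / 2 -> `|z.2 - x.2| <= r / 2 -> enorm (z - y) <= r / 4 ->
  U z - U y <= M * enorm (z - y).
Proof.
move=> y1 y2 z1 z2 zy.
have inQ (w : plane R) : `|w.1 - x.1| <= r / 2 -> `|w.2 - x.2| <= r / 2 -> Q w.
  rewrite !ler_norml => /andP[? ?] /andP[? ?].
  by split; rewrite /= in_itv/=; apply/andP; split; lra.
rewrite !UE; [|exact: inQ|exact: inQ].
exact: (slope_bound uO r0 n0 BO uP).
Qed.

Section tests.
Variables (w : R) (f h : R -> R).
Hypotheses (wr : w <= r / 2) (sf : smooth f) (sh : smooth h).
Hypothesis f0 : forall t, t \notin `[x.1 - w, x.1 + w] -> f t = 0.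
Hypothesis h0 : forall t, t \notin `[x.2 - w, x.2 + w] -> h t = 0.

Let S := (`[x.1 - w, x.1 + w] `*` `[x.2 - w, x.2 + w])%classic : set (plane R).

Let SQ : S `<=` Q.
Proof.
have := wr; move=> ? z [/=]; rewrite !in_itv/= => /andP[? ?] /andP[? ?].
by split; rewrite /= in_itv/=; apply/andP; split; lra.
Qed.

Let SO : S `<=` Omega. Proof. exact: subset_trans SQ QO. Qed.

Let restrict (F : plane R -> R) f' h' :
  (forall t, t \notin `[x.1 - w, x.1 + w] -> f' t = 0) ->
  (forall t, t \notin `[x.2 - w, x.2 + w] -> h' t = 0) ->
  (\int[lebesgue2]_(z in Omega) (F z * tens f' h' z)%:E
    = \int[lebesgue2]_z ((F \_ Q) z * tens f' h' z)%:E)%E.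
Proof.
move=> f'0 h'0.
have t0 z : ~ S z -> tens f' h' z = 0 by exact: tens_out.
rewrite (@integral_supported _ _ _ _ Omega S) => //; last by move=> z /t0 ->; rewrite mulr0.
apply: eq_integral => z _; have [Sz|/t0->] := pselect (S z); last by rewrite !mulr0.
by rewrite /patch mem_set//; exact: SQ.
Qed.

Lemma weak_gradient1 :
  pint (fun z : plane R => U z * tens (derive1 f) h z) =
    - pint (fun z : plane R => G1 z * tens f h z).
Proof.
case: ug => _ _ _ /(_ _ (test_function_tens sf sh f0 h0 SO))[+ _].
rewrite d1_tens// (restrict _ (deriv_out_itv sf f0) h0) (restrict _ f0 h0) => H.
by rewrite /pint /Rintegral H fineN.
Qed.

Lemma weak_gradient2 :
  pint (fun z : plane R => U z * tens f (derive1 h) z) =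
    - pint (fun z : plane R => G2 z * tens f h z).
Proof.
case: ug => _ _ _ /(_ _ (test_function_tens sf sh f0 h0 SO))[_ +].
rewrite d2_tens// (restrict _ f0 (deriv_out_itv sh h0)) (restrict _ f0 h0) => H.
by rewrite /pint /Rintegral H fineN.
Qed.

End tests.

Let Qo := (`]x.1 - 15 / 32 * r, x.1 + 15 / 32 * r[ `*`
          `]x.2 - 15 / 32 * r, x.2 + 15 / 32 * r[)%classic : set (plane R).

Let wr15 : 15 / 32 * r <= r / 2. Proof. move: r0; lra. Qed.
Let wr7 : 7 / 16 * r <= r / 2. Proof. move: r0; lra. Qed.

Let gradient_ae : \forall z \ae lebesgue2, Qo z -> enorm ((G1 z, G2 z) : plane R) <= M.
Proof.
apply: (gradient_le_ae r0 M0 IU IG1 IG2 slope).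
  by move=> f h sf sh f0 h0; exact: (weak_gradient1 wr15).
by move=> f h sf sh f0 h0; exact: (weak_gradient2 wr15).
Qed.

(* Redefining the gradient as 0 off the set where the bound holds changes none of
   the integrals against tests and makes every integrand bounded. *)
Let S := Qo `&` [set z | enorm ((G1 z, G2 z) : plane R) <= M].
Let K1 := G1 \_ S.
Let K2 := G2 \_ S.

Let mG1 : measurable_fun setT G1. Proof. exact: integ_measurable. Qed.
Let mG2 : measurable_fun setT G2. Proof. exact: integ_measurable. Qed.

Let mS : measurable S.
Proof.
apply: measurableI; first exact: measurable_rectangle.
rewrite (_ : [set z | _] = (fun z => G1 z * G1 z + G2 z * G2 z) @^-1` `]-oo,
  M ^+ 2]%classic).
  rewrite -[X in measurable X]setTI.
  suff : measurable_fun setT (fun z => G1 z * G1 z + G2 z * G2 z).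
    by apply => //; exact: measurable_itv.
  by apply: measurable_funD; apply: measurable_funM.
apply/seteqP; split=> z /=; rewrite in_itv/= -(sqr_enorm (G1 z, G2 z)).
  by rewrite ler_pXn2r// nnegrE enorm_ge0.
by rewrite ler_pXn2r// nnegrE enorm_ge0.
Qed.

Let mK1 : measurable_fun setT K1.
Proof. exact: measurable_fun_patch measurableT mS (@subsetT _ _) mG1. Qed.
Let mK2 : measurable_fun setT K2.
Proof. exact: measurable_fun_patch measurableT mS (@subsetT _ _) mG2. Qed.

Let KM z : enorm ((K1 z, K2 z) : plane R) <= M.
Proof.
rewrite /K1 /K2 /patch; case: ifPn => [|_]; first by rewrite inE => -[].
by rewrite /enorm /dot /= mulr0 addr0 sqrtr0.
Qed.

Let K_ae : \forall z \ae lebesgue2, Qo z -> K1 z = G1 z /\ K2 z = G2 z.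
Proof.
apply: ae_impl gradient_ae => z zM Qz.
by rewrite /K1 /K2 /patch mem_set//; split => //; exact: zM.
Qed.

Let supp (c : R) (f : R -> R) := forall t, t \notin `[c - 7 / 16 * r, c + 7 / 16 * r] ->
  f t = 0.

Let tens0 f h z : supp x.1 f -> supp x.2 h -> ~ Qo z -> tens f h z = 0.
Proof.
move=> f0 h0 zQ; apply: (tens_out f0 h0) => -[/=];
  rewrite !in_itv/= => /andP[? ?] /andP[? ?].
move: r0 => rr.
by apply: zQ; split; rewrite /= in_itv/=; apply/andP; split; lra.
Qed.

Let weakK1 f h : smooth f -> smooth h -> supp x.1 f -> supp x.2 h ->
  pint (fun z : plane R => U z * tens (derive1 f) h z) =
    - pint (fun z : plane R => K1 z * tens f h z).
Proof.
move=> sf sh f0 h0; rewrite (weak_gradient1 wr7)//; congr (- _).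
have mt : measurable_fun setT (tens f h) by apply: measurable_tens;
  exact: smooth_continuous.
apply: pint_ae_eq; [exact: measurable_funM|exact: measurable_funM|].
apply: ae_impl K_ae => z GK; have [/GK[-> _]//|zQ] := pselect (Qo z).
by rewrite (tens0 f0 h0 zQ) !mulr0.
Qed.

Let weakK2 f h : smooth f -> smooth h -> supp x.1 f -> supp x.2 h ->
  pint (fun z : plane R => U z * tens f (derive1 h) z) =
    - pint (fun z : plane R => K2 z * tens f h z).
Proof.
move=> sf sh f0 h0; rewrite (weak_gradient2 wr7)//; congr (- _).
have mt : measurable_fun setT (tens f h) by apply: measurable_tens;
  exact: smooth_continuous.
apply: pint_ae_eq; [exact: measurable_funM|exact: measurable_funM|].
apply: ae_impl K_ae => z GK; have [/GK[_ ->]//|zQ] := pselect (Qo z).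
by rewrite (tens0 f0 h0 zQ) !mulr0.
Qed.

Let UP z : (`[x.1 - 7 / 16 * r, x.1 + 7 / 16 * r] `*`
    `[x.2 - 7 / 16 * r, x.2 + 7 / 16 * r])%classic z ->
  `|U z - aff_eval P z| <= n * r.
Proof.
move=> [/=]; rewrite !in_itv/= => /andP[? ?] /andP[? ?]; move: r0 => rr.
have Qz : Q z by split; rewrite /= in_itv/=; apply/andP; split; lra.
by rewrite UE//; apply: uP; exact: QB.
Qed.

(** On the support of the test the weak gradient and its bounded replacement agree almost
    everywhere, so the pairing equals a finite integral to which [pint_det_density_le] applies. *)
Lemma neg_det_hessian_le f h k l (A B delta : R) :
  smooth f -> smooth h -> smooth k -> smooth l ->
  (forall t, t \notin `[x.1 - 3 / 8 * r, x.1 + 3 / 8 * r] -> f t = 0) ->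
  (forall t, t \notin `[x.2 - 3 / 8 * r, x.2 + 3 / 8 * r] -> h t = 0) ->
  supp x.1 k -> supp x.2 l ->
  (forall t, `|f t| <= 1) -> (forall t, `|h t| <= 1) ->
  (forall t, `|derive1 f t| <= A / r) -> (forall t, `|derive1 h t| <= A / r) ->
  (forall t, `|derive1 (derive1 f) t| <= A / r ^+ 2) ->
  (forall t, `|derive1 (derive1 h) t| <= A / r ^+ 2) ->
  (forall t, 0 <= k t <= 1) -> (forall t, 0 <= l t <= 1) ->
  (forall t, `|derive1 k t| <= B / r) -> (forall t, `|derive1 l t| <= B / r) ->
  (forall t, t \in `[x.1 - 3 / 8 * r, x.1 + 3 / 8 * r] -> delta <= k t) ->
  (forall t, t \in `[x.2 - 3 / 8 * r, x.2 + 3 / 8 * r] -> delta <= l t) ->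
  0 <= A -> 0 <= B -> 0 < delta ->
  (neg_det_hessian Omega g (tens f h) <= (2^-1 *
    ((A + A ^+ 2) / delta ^+ 2 * ((64 + 4 * B) * (n * (enorm (aff_slope P) + n)))))%:E)%E.
Proof.
move=> sf sh sk sl f0 h0 k0 l0 f1 h1 fA hA fA2 hA2 k1 l1 kB lB kd ld A0 B0 d0.
have E := pint_det_density_le r0 n0 (erefl M) IU UP mK1 mK2 KM weakK1 weakK2 sf sh sk sl
  f0 h0 k0 l0 f1 h1 fA hA fA2 hA2 k1 l1 kB lB kd ld A0 B0 d0.
rewrite /neg_det_hessian EFinM lee_pmul2l// ?fin_numE//.
suff -> : (\int[lebesgue2]_(z in Omega)
     (enorm (g z) ^+ 2 * laplacian (tens f h) z - hessian_form (tens f h) z (g z))%:E =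
   (pint (det_density K1 K2 f h))%:E)%E by rewrite lee_fin.
have [_ sf'] := smooth_deriv sf; have [_ sh'] := smooth_deriv sh.
have f0' := deriv_out_itv sf f0; have h0' := deriv_out_itv sh h0.
have [_ sf''] := smooth_deriv sf'; have [_ sh''] := smooth_deriv sh'.
have f0'' := deriv_out_itv sf' f0'; have h0'' := deriv_out_itv sh' h0'.
have rr := r0.
pose S8 := (`[x.1 - 3 / 8 * r, x.1 + 3 / 8 * r] `*` `[x.2 - 3 / 8 * r,
  x.2 + 3 / 8 * r])%classic : set (plane R).
have S8Q : S8 `<=` Q.
  move=> z [/=]; rewrite !in_itv/= => /andP[? ?] /andP[? ?].
  by split; rewrite /= in_itv/=; apply/andP; split; lra.
have S8Qo : S8 `<=` Qo.
  move=> z [/=]; rewrite !in_itv/= => /andP[? ?] /andP[? ?].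
  by split; rewrite /= in_itv/=; apply/andP; split; lra.
have det0 F1 F2 z : ~ S8 z -> det_density F1 F2 f h z = 0.
  move=> zS; rewrite /det_density (tens_out f0 h0'' zS) (tens_out f0'' h0 zS).
  by rewrite (tens_out f0' h0' zS) !mulr0 addr0 subr0.
have K1M z : `|K1 z| <= M by exact: le_trans (normr_fst_le (K1 z, K2 z)) (KM z).
have K2M z : `|K2 z| <= M by exact: le_trans (normr_snd_le (K1 z, K2 z)) (KM z).
have wide (w : R) t : t \notin `[w - 7 / 16 * r, w + 7 / 16 * r] ->
  t \notin `[w - 3 / 8 * r, w + 3 / 8 * r].
  by apply: contra; rewrite !in_itv/= => /andP[? ?]; apply/andP; split; lra.
have Idet : integ (det_density K1 K2 f h).
  by apply: (@integ_det_density _ x r K1 K2 f h M) => // t /wide; [exact: f0|exact: h0].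
have mt f' h' : smooth f' -> smooth h' -> measurable_fun setT (tens f' h').
  by move=> ? ?; apply: measurable_tens; exact: smooth_continuous.
have mdet : measurable_fun setT (det_density G1 G2 f h).
  apply: measurable_funB; first apply: measurable_funD.
  - by apply: measurable_funM; [exact: measurable_funX|exact: mt].
  - by apply: measurable_funM; [exact: measurable_funX|exact: mt].
  - apply: measurable_funM; last exact: mt.
    by apply: measurable_funM => //; apply: measurable_funM.
transitivity (\int[lebesgue2]_(z in Omega) (det_density G1 G2 f h z)%:E)%E.
  apply: eq_integral => z _; congr EFin; rewrite neg_det_hessian_tens//.
  have [Sz|zS] := pselect (S8 z); last by rewrite !det0.
  by rewrite /det_density /G1 /G2 /patch mem_set//; exact: S8Q.
rewrite (@integral_supported _ _ _ _ Omega S8); last 2 first.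
- exact: subset_trans S8Q QO.
- by move=> z /det0 ->.
rewrite /pint /Rintegral fineK; last exact: (integrable_fin_num measurableT Idet).
apply: ae_eq_integral => //.
- exact/measurable_EFinP.
- exact: measurable_int Idet.
apply: ae_impl K_ae => z GK _ /=; congr EFin.
have [/S8Qo/GK[E1 E2]|zS] := pselect (S8 z); last by rewrite !det0.
by rewrite /det_density E1 E2.
Qed.

End gradient_of_inf_harmonic.

(** * From the pairing to the mass of the quarter ball *)

Section conclusion.
Context {R : realType}.

(** Markov's inequality, which turns a bound on the pairing into one on the mass of [B]. *)
Lemma tens_ge0_integral_ball (mu : {measure set (plane R) ->
  \bar R}) (Omega B : set (plane R))
    (psi : plane R -> R) (d : R) : measurable Omega -> measurable B -> B `<=` Omega ->
  measurable_fun setT psi -> (forall z, 0 <= psi z) -> 0 <= d -> (forall z, B z ->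
    d <= psi z) ->
  (d%:E * mu B <= \int[mu]_(z in Omega) (psi z)%:E)%E.
Proof.
move=> mO mB BO mpsi psi0 d0 dpsi.
have mE D : measurable_fun D (EFin \o psi).
  by apply/measurable_EFinP; exact: measurable_funS mpsi.
rewrite -integral_cst//.
have psiE z : (0 <= (psi z)%:E)%E by rewrite lee_fin.
apply: (@le_trans _ _ (\int[mu]_(z in B) (psi z)%:E)%E); last first.
  have H := @ge0_subset_integral _ _ _ mu B Omega mB mO (EFin \o psi) (mE _) (fun z _ =>
    psiE z) BO.
  exact: H.
apply: ge0_le_integral => // z Bz; rewrite lee_fin; exact: dpsi.
Qed.

Lemma Linfty_norm_ge0 (B : set (plane R)) (F : plane R -> R) : (0 <= Linfty_norm B F)%E.
Proof. exact: Lnorm_ge0. Qed.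

(** Here [n] stands for any real bound of |u - P| / r on the ball. The cutoffs depend on the data
    only through translation and scaling by r, so all constants are fixed beforehand. *)
Lemma quarter_ball_bound : exists2 C : R, 0 < C & forall Omega u (g : plane R -> plane R)
    (mu : {measure set (plane R) -> \bar R}) (x : plane R) (r n : R) (P : @affine_fun R),
  open Omega -> inf_harmonic Omega u -> W12loc_grad Omega u g ->
  (forall psi, test_function Omega psi ->
      (\int[mu]_(x in Omega) (psi x)%:E)%E = neg_det_hessian Omega g psi) ->
  0 < r -> 0 <= n -> compactly_contained (eball x r) Omega ->
  (forall y, enorm (y - x) < r -> `|u y - aff_eval P y| <= n * r) ->
  (mu (eball x (r / 4)) <= (C * (n * (enorm (aff_slope P) + n)))%:E)%E.
Proof.
have [A A0 HA] := @scaled_bump_bounds R (3 / 8).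
have [B B0 HB] := @scaled_bump_bounds R (7 / 16).
(* Lower bounds for [scaled_bump_ge]: the tested cutoff, of half-width 3/8, is seen on the quarter
   ball, and the energy cutoff, of half-width 7/16, on the support of the tested one. [d1] bounds a
   product of two cutoffs, [delta] a single one. *)
pose e1 : R := expinv (3 / 8 - 1 / 4); pose e2 : R := expinv (7 / 16 - 3 / 8).
have e10 : 0 < e1 by apply: expinv_gt0; lra.
have e20 : 0 < e2 by apply: expinv_gt0; lra.
pose d1 := (e1 * e1) * (e1 * e1); pose delta := e2 * e2.
have d10 : 0 < d1 by rewrite !mulr_gt0.
have d0 : 0 < delta by rewrite mulr_gt0.
pose K := 2^-1 * ((A + A ^+ 2) / delta ^+ 2 * (64 + 4 * B)).
have K0 : 0 <= K.
  by rewrite !mulr_ge0 ?invr_ge0 ?addr_ge0 ?sqr_ge0 ?mulr_ge0.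
(* Adding 1 makes the constant positive, only [0 <= K] being at hand. *)
exists (K / d1 + 1); first by rewrite ltr_wpDl// divr_ge0// ltW.
move=> Omega u g mu x r n P oO uO ug muE r0 n0 BO uP.
pose bp (c : R) := scaled_bump (3 / 8) c r; pose bq (c : R) := scaled_bump (7 / 16) c r.
have sp c : smooth (bp c) by exact: smooth_scaled_bump.
have sq c : smooth (bq c) by exact: smooth_scaled_bump.
have p0 c t : t \notin `[c - 3 / 8 * r, c + 3 / 8 * r] ->
  bp c t = 0 by exact: scaled_bump_out.
have q0 c t : t \notin `[c - 7 / 16 * r, c + 7 / 16 * r] ->
  bq c t = 0 by exact: scaled_bump_out.
have p1 c t : `|bp c t| <= 1 by have /andP[? ?] := scaled_bump01 (3 / 8) c r t;
  rewrite ger0_norm.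
have pA c t := (HA c r t r0).1; have pA2 c t := (HA c r t r0).2;
  have qB c t := (HB c r t r0).1.
have q1 c t : 0 <= bq c t <= 1 by exact: scaled_bump01.
have qd c t : t \in `[c - 3 / 8 * r, c + 3 / 8 * r] ->
  delta <= bq c t by exact: scaled_bump_ge.
have E := neg_det_hessian_le oO uO ug r0 n0 BO uP (sp x.1) (sp x.2) (sq x.1) (sq x.2)
  (p0 x.1) (p0 x.2) (q0 x.1) (q0 x.2) (p1 x.1) (p1 x.2) (pA x.1) (pA x.2) (pA2 x.1) (pA2
    x.2)
  (q1 x.1) (q1 x.2) (qB x.1) (qB x.2) (qd x.1) (qd x.2) A0 B0 d0.
have ballO : eball x r `<=` Omega by move=> z Bz; apply: BO.2; apply: subset_closure.
have sqO : (`[x.1 - 3 / 8 * r, x.1 + 3 / 8 * r] `*` `[x.2 - 3 / 8 * r,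
  x.2 + 3 / 8 * r])%classic `<=` Omega.
  by apply: subset_trans ballO; apply: square_sub_eball => //; lra.
rewrite -(muE _ (test_function_tens (sp x.1) (sp x.2) (p0 x.1) (p0 x.2) sqO)) in E.
have D : (d1%:E * mu (eball x (r / 4)) <=
    \int[mu]_(z in Omega) (tens (bp x.1) (bp x.2) z)%:E)%E.
  apply: tens_ge0_integral_ball.
  - exact: open_measurable_plane.
  - by apply: open_measurable_plane; exact: open_eball.
  - have r4 : r / 4 <= r by lra.
    by move=> z zr; apply: ballO; exact: lt_le_trans zr r4.
  - by apply: measurable_tens; exact: smooth_continuous.
  - by move=> z; rewrite /tens mulr_ge0 ?bump_ge0.
  - exact: ltW.
  move=> z zr; rewrite /tens /d1.
  have H (c t : R) : `|t - c| <= enorm (z - x) -> e1 * e1 <= bp c t.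
    move=> /le_lt_trans/(_ zr); rewrite ltr_norml => /andP[? ?].
    by apply: scaled_bump_ge => //; rewrite in_itv/=; apply/andP; split; lra.
  have e11 : 0 <= e1 * e1 by rewrite mulr_ge0 ?ltW.
  by rewrite ler_pM//; apply: H;
    [exact: (normr_fst_le (z - x))|exact: (normr_snd_le (z - x))].
have {E D} := le_trans D E; rewrite -lee_pdivlMl// -EFinM => /le_trans; apply.
rewrite lee_fin; have an0 := enorm_ge0 (aff_slope P).
set Z := n * _; have Z0 : 0 <= Z by rewrite mulr_ge0// addr_ge0.
have -> : d1^-1 * (2^-1 * ((A + A ^+ 2) / delta ^+ 2 * ((64 + 4 * B) * Z))) = K / d1 * Z.
  by rewrite /K; field; rewrite !gt_eqF.
by rewrite mulrDl lerDl mul1r.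
Qed.

End conclusion.

Theorem proposition2p5 (R : realType) :
  exists C : R, 0 < C /\
    forall (Omega : set (plane R)) (u : plane R -> R),
      domain Omega -> inf_harmonic Omega u ->
    forall mu : {measure set (plane R) -> \bar R},
      neg_det_hessian_measure Omega u mu ->
    forall (x : plane R) (r : R),
      0 < r -> compactly_contained (eball x r) Omega ->
      (mu (eball x (r / 4))
       <= C%:E * ereal_inf
            [set (let N := Linfty_norm (eball x r)
                             (fun y => (u y - aff_eval P y) / r)%R in
                  N * ((enorm (aff_slope P))%:E + N))
            | P in [set: @affine_fun R]])%E.
Proof.
have [C C0 HC] := @quarter_ball_bound R; exists C; split => //.
move=> Omega u [_ oO _] uO mu [_ [g ug muE]] x r r0 BO.
(* Dividing by [C] leaves a lower bound of the infimum, checked for one [P] at a time. *)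
rewrite -lee_pdivrMl//; apply: le_ereal_inf_tmp => _ [P _ <-] /=.
rewrite lee_pdivrMl//.
set F := fun y : plane R => (u y - aff_eval P y) / r.
have [[uC _] _ _] := uO.
have cF z : eball x r z -> {for z, continuous F}.
  move=> Bz; have Oz : Omega z by apply: BO.2; apply: subset_closure.
  have cP : cont (aff_eval P) by rewrite /aff_eval /dot; cont_poly.
  apply: continuousM; last exact: cst_continuous.
  by apply: continuousB; [exact: (uC z Oz)|exact: cP].
have := Linfty_norm_ge0 (eball x r) F.
case NE : (Linfty_norm (eball x r) F) => [n| |] // n0.
  rewrite -EFinD -!EFinM; apply: (HC _ _ _ _ _ _ _ _ oO uO ug muE r0 _ BO) => //.
  move=> y yr; have := @Linfty_norm_le _ x r n F cF; rewrite NE lexx => /(_ isT y yr).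
  by rewrite /F normrM normfV (gtr0_norm r0) ler_pdivrMr.
(* When the norm is infinite so is the right-hand side, and the claim is trivial. *)
by rewrite addey ?ltNye// mulyy mulry gtr0_sg// mul1e leey.
Qed.
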